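(* Assume Slater's condition: there exists $\widetilde X\in\mathcal S$ with $J_c(\widetilde X)<\bar\rho$. Let $\mu^1\ge0$ and let $\{(X^k,\mu^k)\}_{k\ge1}$ be generated by the model-based primal-dual iteration $$X^k=\operatorname{argmin}_{X\in\mathcal S}\mathcal L(X,\mu^k),\qquad d^k=J_c(X^k)-\bar\rho,\qquad\mu^{k+1}=[\mu^k+\zeta^kd^k]_+,$$ with stepsizes $\zeta^k=\mathcal O(k^{-1/2})$, where $[x]_+=\max\{0,x\}$. Let $\bar\mu^k=\frac1k\sum_{i=1}^k\mu^i$. Then $$D^*-D(\bar\mu^k)\le\mathcal O(k^{-1/2}),$$ where $D(\mu)=\min_{X\in\mathcal S}\mathcal L(X,\mu)$ and the maximum of the dual function, $D^*=\max_{\mu\ge0}D(\mu)$, is finite.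
   Context: Setting. $x_{t+1}=Ax_t+Bu_t+w_t$ with $x_t\in\mathbb R^n$, $u_t\in\mathbb R^m$; $\{w_t\}$ is an i.i.d. sequence with finite fourth moments, mean $\bar w=\mathbb E[w_t]$ and covariance $W=\mathbb E[(w_t-\bar w)(w_t-\bar w)^\top]>0$ (positive definite). $Q$ is positive semi-definite, $R$ is positive definite, $(A,B)$ is controllable and $(A,Q^{1/2})$ is observable. Let $M_3=\mathbb E[(w_t-\bar w)(w_t-\bar w)^\top Q(w_t-\bar w)]$, $m_4=\mathbb E[((w_t-\bar w)^\top Q(w_t-\bar w)-\operatorname{tr}\{WQ\})^2]$, and $\bar\rho=\rho_0-m_4+4\operatorname{tr}\{(WQ)^2\}$, where $\rho_0>0$ is a given risk tolerance. A policy is $X=[K,l]$ with $K\in\mathbb R^{m\times n}$, $l\in\mathbb R^m$, meaning $u_t=-Kx_t+l$. $\mathcal S=\{[K,l]:\rho(A-BK)<1\}$ ($\rho(\cdot)$ = spectral radius). For $X\in\mathcal S$, $J(X)=\lim_{T\to\infty}\tfrac1T\mathbb E[\sum_{t=0}^{T-1}(x_t^\top Qx_t+u_t^\top Ru_t)]$ and $J_c(X)=\lim_{T\to\infty}\tfrac1T\mathbb E[\sum_{t=0}^{T-1}(4x_t^\top QWQx_t+4x_t^\top QM_3)]$. For $\mu\ge0$, $\mathcal L(X,\mu)=J(X)+\mu(J_c(X)-\bar\rho)$; it has a unique minimizer over $X\in\mathcal S$.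
   Formalization: The stepsizes are taken of exact order k^{-1/2}, i.e. a/√k ≤ ζ^k ≤ b/√k for all k ≥ 1 with constants a, b > 0; with only the upper bound the claim fails, e.g. for ζ^k = 0 and μ^1 not a maximizer of D. *)

(* Defs.v *)
From HB Require Import structures.
From mathcomp Require Import all_boot all_order all_algebra.
From mathcomp Require Import complex.
From mathcomp Require Import all_classical all_reals all_analysis.

Set Implicit Arguments.
Unset Strict Implicit.
Unset Printing Implicit Defensive.

Import Order.TTheory GRing.Theory Num.Theory.
Import numFieldNormedType.Exports.

Local Open Scope classical_set_scope.
Local Open Scope ring_scope.

Definition qform (R : realType) (n : nat) (M : 'M[R]_n) (x : 'cV[R]_n) : R :=
  (x^T *m M *m x) 0 0.

Definition psdmx (R : realType) (n : nat) (M : 'M[R]_n) : Prop :=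
  M^T = M /\ forall x : 'cV[R]_n, 0 <= qform M x.

Definition pdmx (R : realType) (n : nat) (M : 'M[R]_n) : Prop :=
  M^T = M /\ forall x : 'cV[R]_n, x != 0 -> 0 < qform M x.

(* [S] is the principal square root of [M]; it is unique. *)
Definition is_sqrtmx (R : realType) (n : nat) (M S : 'M[R]_n) : Prop :=
  psdmx S /\ S *m S = M.

Definition controllable (R : realType) (n m : nat)
    (A : 'M[R]_n) (B : 'M[R]_(n, m)) : Prop :=
  \rank (\mxrow_(i < n) (A ^+ i *m B)) = n.

Definition observable (R : realType) (n p : nat)
    (A : 'M[R]_n) (C : 'M[R]_(p, n)) : Prop :=
  \rank (\mxcol_(i < n) (C *m A ^+ i)) = n.

(* The supremum is over a finite set of moduli; it is 0 when [n = 0]. *)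
Definition spectral_radius (R : realType) (n : nat) (M : 'M[R]_n) : R :=
  sup [set ComplexField.Normc.normc z
      | z in [set z : R[i] | eigenvalue (map_mx (real_complex R) M) z]].

Definition borel_cV (R : realType) (n : nat) : set (set 'cV[R]_n) :=
  <<s [set C | exists (i : 'I_n) (b : set R),
         measurable b /\ C = [set v : 'cV[R]_n | b (v i 0)]] >>.

Definition random_vector (d : measure_display) (T : measurableType d)
    (R : realType) (n : nat) (V : T -> 'cV[R]_n) : Prop :=
  forall b, borel_cV b -> measurable (V @^-1` b).

Definition mutually_independent (d : measure_display) (T : measurableType d)
    (R : realType) (P : probability T R) (n : nat) (w : nat -> T -> 'cV[R]_n)
    : Prop :=
  forall (s : seq nat) (b : nat -> set 'cV[R]_n), uniq s ->
    (forall t, borel_cV (b t)) ->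
    P (\bigcap_(t in [set` s]) (w t @^-1` b t)) =
      (\prod_(t <- s) P (w t @^-1` b t))%E.

Definition identically_distributed (d : measure_display)
    (T : measurableType d) (R : realType) (P : probability T R) (n : nat)
    (w : nat -> T -> 'cV[R]_n) : Prop :=
  forall (t : nat) b, borel_cV b -> P (w t @^-1` b) = P (w 0%N @^-1` b).

Definition iid (d : measure_display) (T : measurableType d) (R : realType)
    (P : probability T R) (n : nat) (w : nat -> T -> 'cV[R]_n) : Prop :=
  [/\ forall t, random_vector (w t), mutually_independent P w
    & identically_distributed P w].

Definition finite_moment (d : measure_display) (T : measurableType d)
    (R : realType) (P : probability T R) (n : nat) (p : nat)
    (V : T -> 'cV[R]_n) : Prop :=
  forall i : 'I_n, ('E_P[fun o => (`|V o i ord0| ^+ p)%R] < +oo)%E.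

Definition Er (d : measure_display) (T : measurableType d) (R : realType)
    (P : probability T R) (f : T -> R) : R := fine 'E_P[f].

Definition Emx (d : measure_display) (T : measurableType d) (R : realType)
    (P : probability T R) (p q : nat) (Z : T -> 'M[R]_(p, q)) : 'M[R]_(p, q) :=
  \matrix_(i, j) Er P (fun o => Z o i j).

(* [x0] is an arbitrary random initial state. *)
Record lqr (d : measure_display) (T : measurableType d) (R : realType)
    (P : probability T R) (n m : nat) := Lqr {
  mA : 'M[R]_n;
  mB : 'M[R]_(n, m);
  mQ : 'M[R]_n;
  mR : 'M[R]_m;
  noise : nat -> T -> 'cV[R]_n;
  x0 : T -> 'cV[R]_n;
  rho0 : R }.

(* [(K, l)] stands for the control law [u_t = - K x_t + l]. *)
Definition policy (R : realType) (n m : nat) : Type :=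
  ('M[R]_(m, n) * 'cV[R]_m)%type.

(* As the noise is identically distributed, its moments are those of
   [noise s 0]. *)
Definition wbar (d : measure_display) (T : measurableType d) (R : realType)
    (P : probability T R) (n m : nat) (s : lqr P n m) : 'cV[R]_n :=
  Emx P (noise s 0%N).

Definition wc (d : measure_display) (T : measurableType d) (R : realType)
    (P : probability T R) (n m : nat) (s : lqr P n m) (o : T) : 'cV[R]_n :=
  noise s 0%N o - wbar s.

Definition covW (d : measure_display) (T : measurableType d) (R : realType)
    (P : probability T R) (n m : nat) (s : lqr P n m) : 'M[R]_n :=
  Emx P (fun o => wc s o *m (wc s o)^T).

Definition M3 (d : measure_display) (T : measurableType d) (R : realType)
    (P : probability T R) (n m : nat) (s : lqr P n m) : 'cV[R]_n :=
  Emx P (fun o => wc s o *m (wc s o)^T *m mQ s *m wc s o).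

Definition m4 (d : measure_display) (T : measurableType d) (R : realType)
    (P : probability T R) (n m : nat) (s : lqr P n m) : R :=
  Er P (fun o => (qform (mQ s) (wc s o) - \tr (covW s *m mQ s)) ^+ 2).

Definition rhobar (d : measure_display) (T : measurableType d) (R : realType)
    (P : probability T R) (n m : nat) (s : lqr P n m) : R :=
  rho0 s - m4 s + 4 * \tr ((covW s *m mQ s) ^+ 2).

Definition control (R : realType) (n m : nat) (X : policy R n m)
    (x : 'cV[R]_n) : 'cV[R]_m :=
  - (X.1 *m x) + X.2.

Fixpoint state (d : measure_display) (T : measurableType d) (R : realType)
    (P : probability T R) (n m : nat) (s : lqr P n m) (X : policy R n m)
    (t : nat) (o : T) : 'cV[R]_n :=
  if t is t'.+1 then
    let x := state s X t' o in
    mA s *m x + mB s *m control X x + noise s t' o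
  else x0 s o.

Definition stabilizing (d : measure_display) (T : measurableType d)
    (R : realType) (P : probability T R) (n m : nat) (s : lqr P n m)
    : set (policy R n m) :=
  [set X | spectral_radius (mA s - mB s *m X.1) < 1].

Definition avg_cost (d : measure_display) (T : measurableType d)
    (R : realType) (P : probability T R) (c : nat -> T -> R) : R :=
  limn (fun N : nat => N%:R^-1 * Er P (fun o => \sum_(0 <= t < N) c t o)).

Definition J (d : measure_display) (T : measurableType d) (R : realType)
    (P : probability T R) (n m : nat) (s : lqr P n m) (X : policy R n m) : R :=
  avg_cost P (fun t o => let x := state s X t o in
    qform (mQ s) x + qform (mR s) (control X x)).

Definition Jc (d : measure_display) (T : measurableType d) (R : realType)
    (P : probability T R) (n m : nat) (s : lqr P n m) (X : policy R n m) : R :=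
  avg_cost P (fun t o => let x := state s X t o in
    4 * qform (mQ s *m covW s *m mQ s) x
    + 4 * (x^T *m mQ s *m M3 s) 0 0).

Definition lagrangian (d : measure_display) (T : measurableType d)
    (R : realType) (P : probability T R) (n m : nat) (s : lqr P n m)
    (X : policy R n m) (mu : R) : R :=
  J s X + mu * (Jc s X - rhobar s).

Definition is_argmin (U : Type) (R : realType) (S : set U) (f : U -> R)
    (X : U) : Prop :=
  S X /\ forall Y, S Y -> f X <= f Y.

(* The minimum of the Lagrangian over the stabilizing policies, as an infimum
   in the extended reals, so that no default value is involved. *)
Definition dual (d : measure_display) (T : measurableType d)
    (R : realType) (P : probability T R) (n m : nat) (s : lqr P n m)
    (mu : R) : \bar R :=
  ereal_inf [set (lagrangian s X mu)%:E | X in stabilizing s].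

Definition dual_max (d : measure_display) (T : measurableType d)
    (R : realType) (P : probability T R) (n m : nat) (s : lqr P n m) : \bar R :=
  ereal_sup [set dual s mu | mu in [set mu : R | 0 <= mu]].

(* Stepsizes of exact order [k^(-1/2)]; an upper bound alone would allow
   vanishing stepsizes, for which the iteration does not move. *)
Definition order_invsqrt (R : realType) (zeta : nat -> R) : Prop :=
  exists a b : R, [/\ 0 < a, 0 < b &
    forall k, (1 <= k)%N ->
      a / Num.sqrt k%:R <= zeta k <= b / Num.sqrt k%:R].

(* Sequences are indexed from 1; their value at 0 is irrelevant. *)
Definition primal_dual (d : measure_display) (T : measurableType d)
    (R : realType) (P : probability T R) (n m : nat) (s : lqr P n m)
    (zeta : nat -> R) (X : nat -> policy R n m) (mu : nat -> R) : Prop :=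
  forall k, (1 <= k)%N ->
    is_argmin (stabilizing s) (fun Y => lagrangian s Y (mu k)) (X k) /\
    mu k.+1 = Num.max 0 (mu k + zeta k * (Jc s (X k) - rhobar s)).

Definition running_mean (R : realType) (mu : nat -> R) (k : nat) : R :=
  k%:R^-1 * \sum_(1 <= i < k.+1) mu i.

(* Main.v *)
(* The dual function is the infimum of the affine functions
   mu |-> J X + mu * (Jc X - rhobar), and Jc (X k) - rhobar is a supergradient
   at mu k.  Completing the square bounds Jc below, and Q = Qhalf ^ 2 bounds
   Jc above by an affine function of J; hence the supergradients met by the
   iteration are bounded.  Both bounds are pointwise in the state and pass to
   J and Jc because the second moments of a stable closed loop converge, so
   that the Cesaro limits defining J and Jc exist.
   The multiplier is a scalar, so a step either brings mu k closer to a
   maximizer mus or jumps over it, and in the second case |mu k - mus| and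
   |mu (k+1) - mus| are both O(k^(-1/2)).  In both cases the dual gap at k is at
   most C sqrt(k) (|mu k - mus|^2 - |mu (k+1) - mus|^2) + C / sqrt(k), which
   sums to O(sqrt(k)) whether or not the stepsizes are monotone; concavity of
   the dual function then handles the running mean. *)
Require Import Defs.
From HB Require Import structures.
From mathcomp Require Import all_boot all_order all_algebra.
From mathcomp Require Import complex ring lra.
From mathcomp Require Import all_classical all_reals all_analysis.
From mathcomp Require Import measurable_realfun.
Import Order.TTheory GRing.Theory Num.Theory.
Import numFieldNormedType.Exports.
Local Open Scope classical_set_scope.
Local Open Scope ring_scope.

Set Implicit Arguments.
Unset Strict Implicit.
Unset Printing Implicit Defensive.

(** * Ascent on a concave function of one variable *)

(* The constraints with [g X > 0] bound [mu] below, those with [g X < 0] bound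
   it above.  The supremum of the lower bounds works: two constraints that
   cross below [r] would keep every [mu] away from [r]. *)
Lemma affine_family_max (R : realType) (U : Type) (S : set U) (j g : U -> R)
    (r : R) :
  (exists2 Y, S Y & g Y < 0) ->
  (forall e, 0 < e -> exists2 mu, 0 <= mu &
    forall X, S X -> r - e <= j X + mu * g X) ->
  exists2 mu, 0 <= mu & forall X, S X -> r <= j X + mu * g X.
Proof.
move=> [Y0 SY0 gY0] near_max.
(* With [g Y <= 0], every value at [mu >= 0] is at most [j Y], which thus dominates each [r - e]. *)
have j_ge Y : S Y -> g Y <= 0 -> r <= j Y.
  move=> SY gY; apply/ler_addgt0Pr => e e0.
  have [mu mu0 /(_ _ SY)] := near_max e e0.
  have : mu * g Y <= 0 by rewrite mulr_ge0_le0.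
  lra.
(* Every lower bound on [mu] is at most every upper bound, written without division: the weights
   [- g Y] and [g X] eliminate [mu]. They add up to [g X - g Y], whence the tolerance
   [e / (g X - g Y)]. *)
have cross X Y : S X -> S Y -> 0 < g X -> g Y < 0 ->
    (r - j X) * - g Y <= (j Y - r) * g X.
  move=> SX SY gX gY; apply/ler_addgt0Pr => e e0.
  have d0 : 0 < g X - g Y by lra.
  have [mu mu0 H] := near_max _ (divr_gt0 e0 d0).
  have := H _ SX; have := H _ SY.
  set q := e / _ => HY HX.
  have Eq : e = q * (g X - g Y) by rewrite /q divfK // gt_eqF.
  rewrite Eq.
  have := ler_wpM2r (ltW gX) HY.
  have NgY : 0 <= - g Y by lra.
  have := ler_wpM2r NgY HX.
  lra.
(* The element 0 makes [A] nonempty and its supremum nonnegative. *)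
pose A := [set 0] `|` [set (r - j X) / g X | X in [set X | S X /\ 0 < g X]].
have ubA Y : S Y -> g Y < 0 -> ubound A ((j Y - r) / - g Y).
  move=> SY gY a [->|[X [SX gX] <-]].
    by rewrite divr_ge0 // ?subr_ge0 ?j_ge ?oppr_ge0 ?ltW.
  by rewrite ler_pdivrMr // mulrAC ler_pdivlMr ?oppr_gt0 // cross.
have hsA : has_sup A.
  by split; [exists 0; left|exists ((j Y0 - r) / - g Y0); exact: ubA].
exists (sup A); first by apply: sup_upper_bound => //; left.
move=> X SX.
have [gX|gX|gX] := ltgtP (g X) 0.
- have := ge_sup (proj1 hsA) (ubA _ SX gX).
  rewrite ler_pdivlMr ?oppr_gt0 //.
  lra.
- have : (r - j X) / g X <= sup A.
    by apply: sup_upper_bound => //; right; exists X.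
  rewrite ler_pdivrMr //; lra.
- by rewrite gX mulr0 addr0 j_ge // gX.
Qed.

(* The iterate either moves towards [mus] without passing it, and then the
   distance drops by at least [z * `|d|], or it passes it, and then both
   distances are of the order of the step.  No monotonicity of the stepsizes is
   used. *)
Lemma ascent_step (R : realFieldType) (a b G q z d mu mu' mus gap : R) :
  0 < a -> 0 < b -> 0 < q -> a / q <= z <= b / q -> `|d| <= G ->
  0 <= mus -> mu' = Num.max 0 (mu + z * d) ->
  0 <= gap -> gap <= d * (mus - mu) ->
  gap <= q / a * ((mu - mus) ^+ 2 - (mu' - mus) ^+ 2)
         + (b * G ^+ 2 + (b * G) ^+ 2 / a) / q
  /\ (`|mu' - mus| <= `|mu - mus| \/ `|mu' - mus| <= b * G / q).
Proof.
move=> a0 b0 q0 /andP[az zb] dG mus0 -> gap0 gap_le.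
have z0 : 0 < z by apply: lt_le_trans az; rewrite divr_gt0.
have G0 : 0 <= G by apply: le_trans dG.
(* Clipping at 0 is a projection and cannot increase the distance to [mus >= 0]. *)
have proj : `|Num.max 0 (mu + z * d) - mus| <= `|mu + z * d - mus|.
  rewrite /Num.max; case: ltP => // H; rewrite sub0r normrN.
  rewrite [leRHS]ler0_norm ?[leLHS]ger0_norm //; lra.
set mu1 := Num.max _ _ in proj *.
have sqE (x : R) : x ^+ 2 = `|x| ^+ 2 by rewrite real_normK ?num_real.
have C0 : 0 <= (b * G ^+ 2 + (b * G) ^+ 2 / a) / q.
  by rewrite divr_ge0 ?addr_ge0 ?mulr_ge0 ?invr_ge0 ?exprn_ge0 // ltW.
have gap_abs : gap <= `|d| * `|mu - mus|.
  by rewrite (le_trans gap_le)// -normrM -normrN -mulrN opprB ler_norm.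
have [zd_le|zd_gt] := leP (z * `|d|) `|mu - mus|.
- have dist1 : `|mu1 - mus| <= `|mu - mus| - z * `|d|.
    apply: (le_trans proj).
    (* A nonnegative gap forces [d] to point from [mu] towards [mus]. *)
    have sgn : 0 <= d * (mus - mu) by apply: le_trans gap_le.
    have [d0|d0|d0] := ltgtP d 0; last first.
    + by rewrite d0 normr0 !mulr0 addr0 subr0.
    + move: sgn; rewrite pmulr_rge0 // => sgn.
      move: zd_le; rewrite (gtr0_norm d0) [`|mu - mus|]ler0_norm; last by lra.
      by move=> zd_le; rewrite ler0_norm; lra.
    + move: sgn; rewrite nmulr_rge0 // => sgn.
      move: zd_le; rewrite (ltr0_norm d0) [`|mu - mus|]ger0_norm; last by lra.
      by move=> zd_le; rewrite ger0_norm; lra.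
  have zd0 : 0 <= z * `|d| by rewrite mulr_ge0 // ltW.
  split; last by left; lra.
  rewrite (sqE (mu - _)) (sqE (mu1 - _)).
  set e := `|mu - mus| in gap_abs zd_le dist1 *.
  set e1 := `|mu1 - mus| in dist1 *.
  have e0 : 0 <= e by rewrite normr_ge0.
  have e10 : 0 <= e1 by rewrite normr_ge0.
  apply: (le_trans gap_abs).
  suff : `|d| * e <= q / a * (e ^+ 2 - e1 ^+ 2) by lra.
  (* The lower bound [a / q] on the stepsize converts the drop in distance into a bound on [|d|]. *)
  have dz : `|d| <= q / a * (e - e1).
    have : a / q * `|d| <= e - e1.
      by apply: (@le_trans _ _ (z * `|d|)); [exact: ler_wpM2r|lra].
    rewrite mulrAC ler_pdivrMr // => H.
    rewrite mulrAC ler_pdivlMr // mulrC; lra.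
  apply: (le_trans (ler_wpM2r e0 dz)).
  rewrite -(mulrA (q / a)); apply: ler_wpM2l; first by rewrite divr_ge0 // ltW.
  (* This product is exactly [e ^+ 2 - e1 ^+ 2 - e * (e - e1)]. *)
  have : 0 <= (e - e1) * e1 by rewrite mulr_ge0 //; lra.
  rewrite !expr2; lra.
- have zdG : z * `|d| <= b * G / q.
    rewrite mulrAC; apply: ler_pM => //; exact: ltW.
  have dist1 : `|mu1 - mus| <= b * G / q.
    apply: le_trans zdG; apply: (le_trans proj).
    have sgn : 0 <= d * (mus - mu) by apply: le_trans gap_le.
    have [d0|d0|d0] := ltgtP d 0; last first.
    + by move: zd_gt; rewrite d0 normr0 mulr0 ltNge normr_ge0.
    + move: sgn; rewrite pmulr_rge0 // => sgn.
      move: zd_gt; rewrite (gtr0_norm d0) [`|mu - mus|]ler0_norm; last by lra.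
      by move=> zd_gt; rewrite ger0_norm; lra.
    + move: sgn; rewrite nmulr_rge0 // => sgn.
      move: zd_gt; rewrite (ltr0_norm d0) [`|mu - mus|]ger0_norm; last by lra.
      by move=> zd_gt; rewrite ler0_norm; lra.
  split; last by right.
  have bGq : 0 <= b * G / q by rewrite !mulr_ge0 ?invr_ge0 // ltW.
  have gap_G : gap <= b * G ^+ 2 / q.
    apply: (le_trans gap_abs).
    have e_le := le_trans (ltW zd_gt) zdG.
    apply: (le_trans (ler_pM (normr_ge0 _) (normr_ge0 _) dG e_le)).
    by rewrite expr2; lra.
  have sq1 : (mu1 - mus) ^+ 2 <= (b * G / q) ^+ 2.
    by rewrite (sqE (mu1 - mus)); apply: lerXn2r; rewrite // nnegrE.
  have sq0 : 0 <= (mu - mus) ^+ 2 by rewrite sqr_ge0.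
  have qa : 0 <= q / a by rewrite divr_ge0 // ltW.
  have := ler_wpM2l qa sq1.
  have := mulr_ge0 qa sq0.
  (* After a jump the weighted drop of the squared distance is at least minus this quantity, which
     is the second summand of the constant. *)
  have -> : q / a * (b * G / q) ^+ 2 = (b * G) ^+ 2 / a / q.
    by field; rewrite !gt_eqF.
  rewrite mulrDl mulrBr; lra.
Qed.

(* Summation by parts, with the monotone weights [Num.sqrt i%:R] in place of the
   inverse stepsizes. *)
Lemma ascent_sum (R : realType) (C E a : R) (gap e : nat -> R) :
  0 < a -> 0 <= C ->
  (forall i, (1 <= i)%N -> gap i <=
     Num.sqrt i%:R / a * (e i ^+ 2 - e i.+1 ^+ 2) + C / Num.sqrt i%:R) ->
  (forall i, (1 <= i)%N -> e i ^+ 2 <= E) ->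
  forall k, \sum_(1 <= i < k.+1) gap i <= (2 * C + E / a) * Num.sqrt k%:R.
Proof.
move=> a0 C0 Hgap HE k.
(* The weighted distance left over by the telescoping stays on the left so that the induction
   closes. *)
suff : \sum_(1 <= i < k.+1) gap i + Num.sqrt k%:R / a * e k.+1 ^+ 2
       <= (2 * C + E / a) * Num.sqrt k%:R.
  have : 0 <= Num.sqrt k%:R / a * e k.+1 ^+ 2.
    by rewrite mulr_ge0 ?sqr_ge0 ?divr_ge0 ?sqrtr_ge0 // ltW.
  lra.
elim: k => [|k IH]; first by rewrite big_geq // sqrtr0 !mul0r mulr0 addr0.
rewrite big_nat_recr //=.
have := Hgap k.+1 isT; have := HE k.+1 isT.
have q0 : 0 < Num.sqrt k.+1%:R :> R by rewrite sqrtr_gt0 ltr0n.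
have p0 : 0 <= Num.sqrt k%:R :> R by rewrite sqrtr_ge0.
have qp : Num.sqrt k.+1%:R ^+ 2 = Num.sqrt k%:R ^+ 2 + 1 :> R.
  by rewrite !sqr_sqrtr ?ler0n // -natr1.
have pq : Num.sqrt k%:R <= Num.sqrt k.+1%:R :> R.
  by rewrite ler_wsqrtr // ler_nat.
move: IH q0 p0 qp pq.
set q := Num.sqrt k.+1%:R; set p := Num.sqrt k%:R => IH q0 p0 qp pq HEk Hg.
(* Since [q ^+ 2 - p ^+ 2 = 1], one has [2 * q * (q - p) = 1 + (q - p) ^+ 2], so [1 / q] is at most
   [2 * (q - p)] and telescopes. *)
have Ciq : C / q <= 2 * C * (q - p).
  rewrite ler_pdivrMr //.
  have : 0 <= C * (q - p) ^+ 2 by rewrite mulr_ge0 ?sqr_ge0.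
  suff -> : 2 * C * (q - p) * q = C + C * (q - p) ^+ 2 by lra.
  have -> : C + C * (q - p) ^+ 2
            = C * ((p ^+ 2 + 1) - p ^+ 2 + (q - p) ^+ 2) by ring.
  by rewrite -qp; ring.
(* Raising the weight from [p] to [q] costs [(q - p) / a] times a squared distance, itself at most
   [E]. *)
have Ea : (q - p) / a * e k.+1 ^+ 2 <= E / a * (q - p).
  rewrite mulrAC [leRHS]mulrAC ler_pM2r ?invr_gt0 // mulrC ler_wpM2r //; lra.
rewrite !mulrBr in Hg Ciq Ea *; rewrite mulrBl in Ea; rewrite mulrBl in Ea; lra.
Qed.

(** * Powers of a stable matrix *)

Import ComplexField.Normc.

Lemma normc_ge0 (R : rcfType) (z : R[i]) : 0 <= normc z.
Proof. by case: z => a b; exact: sqrtr_ge0. Qed.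

(** The strict inequality [normc l < r] leaves room for a [D] with [normc l * D + C <= r * D], and
    such a bound reproduces itself along the recursion. *)
Lemma shift_geometric_bound (R : rcfType) (u v : nat -> R[i]) (l : R[i])
    (r C : R) :
  normc l < r -> (forall j, u j.+1 = l * u j + v j) ->
  (forall j, normc (v j) <= C * r ^+ j) ->
  exists D, forall j, normc (u j) <= D * r ^+ j.
Proof.
move=> lr uS vC.
have r0 : 0 < r by exact: le_lt_trans (normc_ge0 _) lr.
have nl0 := normc_ge0 l.
have nu0 := normc_ge0 (u 0%N).
have C0 : 0 <= C.
  have := vC 0%N; rewrite expr0 mulr1; exact/le_trans/normc_ge0.
pose D := normc (u 0%N) + C / (r - normc l).
have D0 : 0 <= D by rewrite addr_ge0 // divr_ge0 // subr_ge0 ltW.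
have DC : C <= D * (r - normc l).
  rewrite /D mulrDl divfK; last by rewrite gt_eqF // subr_gt0.
  by rewrite lerDr mulr_ge0 // subr_ge0 ltW.
exists D; elim=> [|j IH].
  by rewrite expr0 mulr1 lerDl divr_ge0 // subr_ge0 ltW.
rewrite uS (le_trans (le_normcD _ _))// normcM.
have rj : 0 <= r ^+ j by rewrite exprn_ge0 // ltW.
have := vC j; have := ler_wpM2l nl0 IH; have := ler_wpM2r rj DC.
rewrite exprS; lra.
Qed.

(* The factors ['X - l%:P] are removed one at a time, each removal being an
   inhomogeneous first-order recursion with ratio [l]. *)
Lemma annihilated_geometric_bound (R : rcfType) (n : nat) (F : 'M[R[i]]_n.+1)
    (r : R) (a b : 'I_n.+1) (s : seq R[i]) (p : {poly R[i]}) :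
  0 < r -> all (fun l => normc l < r) s ->
  horner_mx F ((\prod_(l <- s) ('X - l%:P)) * p) = 0 ->
  exists C, forall j, normc ((F ^+ j * horner_mx F p) a b) <= C * r ^+ j.
Proof.
move=> r0; elim: s p => [|l s IH] p.
  rewrite big_nil mul1r => _ ->; exists 0 => j.
  by rewrite mulr0 mxE mul0r normc0.
rewrite big_cons => /= /andP[lr sr] H0.
(* With [u j] the entry of [F ^+ j * horner_mx F p], the induction hypothesis at [('X - l%:P) * p]
   bounds [u j.+1 - l * u j]. *)
have [|C HC] := IH (('X - l%:P) * p) sr.
  by rewrite mulrCA mulrA.
apply: (shift_geometric_bound lr _ HC) => j.
rewrite rmorphM rmorphB /= horner_mx_X horner_mx_C.
rewrite mulrBl mulrBr mulrA -exprSr -(scalemx1 _ l) -mulmxE.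
rewrite -scalemxAl mul1mx -scalemxAr.
by rewrite !mxE subrKC.
Qed.

(** Over the complex numbers the characteristic polynomial splits into factors attached to the
    eigenvalues, and it annihilates the matrix by Cayley-Hamilton. The gap between the spectral
    radius and [r] absorbs the polynomial growth due to repeated eigenvalues. *)
Lemma stable_power_bound (R : realType) (n : nat) (F : 'M[R]_n) :
  spectral_radius F < 1 ->
  exists2 r, 0 < r < 1 & forall a b, exists C, forall j,
    `|(F ^+ j) a b| <= C * r ^+ j.
Proof.
case: n F => [|n] F Frho; first by exists (2^-1) => [|[]//]; lra.
set G := map_mx (real_complex R) F.
(* [r] lies strictly between the spectral radius and 1; the maximum with 0 gives [0 < r]
   directly. *)
pose r := (1 + Num.max 0 (spectral_radius F)) / 2.
have m0 : 0 <= Num.max 0 (spectral_radius F) by rewrite le_max lexx.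
have m1 : Num.max 0 (spectral_radius F) < 1 by rewrite gt_max ltr01.
have [rs Ers] := closed_field_poly_normal (char_poly G).
rewrite (monicP (char_poly_monic G)) scale1r in Ers.
have eigrs z : eigenvalue G z = (z \in rs).
  by rewrite eigenvalue_root_char Ers root_prod_XsubC.
have rhoS z : z \in rs -> normc z <= spectral_radius F.
  move=> zrs; apply: sup_upper_bound; last by exists z => //=; rewrite eigrs.
  (* The supremum is an upper bound only once the set is known to be bounded; the sum of the moduli
     of all roots bounds it. *)
  split; first by exists (normc z), z => //=; rewrite eigrs.
  exists (\sum_(l <- rs) normc l) => _ [y /= yS <-].
  move: yS; rewrite eigrs => yS.
  rewrite (big_rem y) //= lerDl sumr_ge0 // => l _.
  exact: normc_ge0.
have all_r : all (fun l => normc l < r) rs.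
  apply/allP => z /rhoS zr; apply: (le_lt_trans zr).
  have : spectral_radius F <= Num.max 0 (spectral_radius F).
    by rewrite le_max lexx orbT.
  rewrite /r; lra.
exists r => [|a b]; first by rewrite /r; lra.
have r0 : 0 < r by rewrite /r; lra.
have [|C HC] := @annihilated_geometric_bound _ _ G r a b rs 1 r0 all_r.
  by rewrite mulr1 -Ers Cayley_Hamilton.
exists C => j; have := HC j.
rewrite rmorph1 mulr1 /G -(rmorphXn (map_mx (real_complex R))).
by rewrite mxE /= expr0n /= addr0 sqrtr_sqr.
Qed.

(** * Expectations of square-integrable variables *)

Lemma Er_cst (d : measure_display) (T : measurableType d) (R : realType)
    (P : probability T R) (c : R) : Er P (fun=> c) = c.
Proof. by rewrite /Er expectation_cst. Qed.

Lemma ErD (d : measure_display) (T : measurableType d) (R : realType)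
    (P : probability T R) (f g : T -> R) :
  f \in Lfun P 1 -> g \in Lfun P 1 ->
  Er P (fun o => f o + g o) = Er P f + Er P g.
Proof.
move=> f1 g1; rewrite /Er expectationD // fineD //; exact: expectation_fin_num.
Qed.

Lemma ErZ (d : measure_display) (T : measurableType d) (R : realType)
    (P : probability T R) (c : R) (f : T -> R) :
  f \in Lfun P 1 -> Er P (fun o => c * f o) = c * Er P f.
Proof.
move=> f1; rewrite /Er -[LHS]/(fine 'E_P[fun o => c * f o]).
have -> : (fun o => c * f o) = c \o* f by apply/funext => o /=; rewrite mulrC.
rewrite expectationZl // fineM //; exact: expectation_fin_num.
Qed.

Lemma Er_sum (d : measure_display) (T : measurableType d) (R : realType)
    (P : probability T R) (I : Type) (s : seq I) (f : I -> T -> R) :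
  (forall i, f i \in Lfun P 1) ->
  (fun o => \sum_(i <- s) f i o) \in Lfun P 1 /\
  Er P (fun o => \sum_(i <- s) f i o) = \sum_(i <- s) Er P (f i).
Proof.
move=> f1; elim: s => [|i s [IH1 IH2]].
  under eq_fun do rewrite big_nil.
  by rewrite big_nil Er_cst; split => //; exact: Lfun_cst.
under eq_fun do rewrite big_cons.
rewrite big_cons ErD // IH2; split => //.
by apply: (@rpredD _ (Lfun P 1)).
Qed.

Lemma Er_ge0 (d : measure_display) (T : measurableType d) (R : realType)
    (P : probability T R) (f : T -> R) :
  (forall o, 0 <= f o) -> 0 <= Er P f.
Proof. by move=> f0; rewrite fine_ge0 // expectation_ge0. Qed.

Lemma Er_le (d : measure_display) (T : measurableType d) (R : realType)
    (P : probability T R) (f g : T -> R) :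
  f \in Lfun P 1 -> g \in Lfun P 1 -> (forall o, f o <= g o) ->
  Er P f <= Er P g.
Proof.
move=> f1 g1 fg; rewrite -subr_ge0.
have -> : Er P g - Er P f = Er P (fun o => g o - f o).
  rewrite /Er (expectationB g1 f1) fineB //; exact: expectation_fin_num.
by apply: Er_ge0 => o; rewrite subr_ge0.
Qed.

Lemma Lfun2_mul (d : measure_display) (T : measurableType d) (R : realType)
    (P : probability T R) (f g : T -> R) :
  f \in Lfun P 2%:E -> g \in Lfun P 2%:E -> (fun o => f o * g o) \in Lfun P 1.
Proof. exact: Lfun2_mul_Lfun1. Qed.

Lemma Lfun2_1 (d : measure_display) (T : measurableType d) (R : realType)
    (P : probability T R) (f : T -> R) : f \in Lfun P 2%:E -> f \in Lfun P 1.
Proof. by apply: Lfun_subset12; exact: fin_num_measure. Qed.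

Lemma Lfun2D (d : measure_display) (T : measurableType d) (R : realType)
    (P : probability T R) (f g : T -> R) :
  f \in Lfun P 2%:E -> g \in Lfun P 2%:E ->
  (fun o => f o + g o) \in Lfun P 2%:E.
Proof. by have [_] := Lfun_addr_closed P (lee1n 2 : (1 <= 2%:E)%E); apply. Qed.

Lemma measurable_Lfun (d : measure_display) (T : measurableType d)
    (R : realType) (P : probability T R) (p : \bar R) (f : T -> R) :
  f \in Lfun P p -> measurable_fun setT f.
Proof. by rewrite inE => /andP[/[!inE]]. Qed.

Lemma Lfun_natP (d : measure_display) (T : measurableType d) (R : realType)
    (P : probability T R) (p : nat) (f : T -> R) :
  measurable_fun setT f -> ('E_P[fun o => (`|f o| ^+ p)%R] < +oo)%E ->
  f \in Lfun P p%:R%:E.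
Proof.
move=> mf; rewrite unlock => fp.
rewrite inE; apply/andP; split; rewrite inE //=.
rewrite /finite_norm unlock /Lnorm poweR_lty //.
under eq_integral => x _ do rewrite poweR_EFin powR_mulrn //.
by [].
Qed.

(** Both expectations are integrals of the identity against the law of the variable, and the two
    laws coincide. *)
Lemma Er_eq_distr (d : measure_display) (T : measurableType d) (R : realType)
    (P : probability T R) (f g : T -> R) :
  f \in Lfun P 1 -> g \in Lfun P 1 ->
  (forall b : set R, measurable b -> P (f @^-1` b) = P (g @^-1` b)) ->
  Er P f = Er P g.
Proof.
move=> f1 g1 fg; rewrite /Er unlock; congr fine.
have mf := measurable_Lfun f1; have mg := measurable_Lfun g1.
pose mu := pushforward P f; pose nu := pushforward P g.
transitivity (\int[mu]_x x%:E)%E.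
  rewrite /mu integral_pushforward //.
  - by rewrite preimage_setT; exact/Lfun1_integrable.
transitivity (\int[nu]_x x%:E)%E.
  by apply: eq_measure_integral => b mb _; exact: fg.
rewrite /nu integral_pushforward //.
by rewrite preimage_setT; exact/Lfun1_integrable.
Qed.

(** Independence identifies the joint law of [(f, g)] with the product of the two laws, and Fubini
    factorizes the integral there; square integrability makes [f * g] integrable. *)
Lemma Er_indep (d : measure_display) (T : measurableType d) (R : realType)
    (P : probability T R) (f g : T -> R) :
  f \in Lfun P 2%:E -> g \in Lfun P 2%:E ->
  (forall b c : set R, measurable b -> measurable c ->
     P (f @^-1` b `&` g @^-1` c) = (P (f @^-1` b) * P (g @^-1` c))%E) ->
  Er P (fun o => f o * g o) = Er P f * Er P g.
Proof.
move=> f2 g2 indep.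
have mf := measurable_Lfun f2; have mg := measurable_Lfun g2.
have [f1 g1] := (Lfun2_1 f2, Lfun2_1 g2).
have fg1 := Lfun2_mul f2 g2.
pose F := mfun_Sub (mem_set mf : f \in mfun).
pose G := mfun_Sub (mem_set mg : g \in mfun).
pose mu := distribution P F; pose nu := distribution P G.
have mh : measurable_fun setT (fun o => (f o, g o)).
  exact: measurable_fun_pair.
pose h := mfun_Sub (mem_set mh : (fun o => (f o, g o)) \in mfun).
pose joint := pushforward P h.
have prodE X : measurable X -> (mu \x nu)%E X = joint X.
  by apply: product_measure_unique => b c mb mc; exact: indep.
pose k (z : R * R) : \bar R := (z.1 * z.2)%:E.
have mmul : measurable_fun setT k.
  by apply/measurable_EFinP; apply: measurable_funM.
have ijoint : joint.-integrable setT k.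
  apply: integrable_pushforward => //.
  by rewrite preimage_setT; exact/Lfun1_integrable.
have iprod : (mu \x nu)%E.-integrable setT k.
  apply/integrableP; split => //.
  have /integrableP[_] := ijoint; congr (_ < _)%E.
  by apply: eq_measure_integral => X mX _; exact/esym/prodE.
rewrite /Er unlock -fineM; last 2 first.
- by apply: integrable_fin_num => //; exact/Lfun1_integrable.
- by apply: integrable_fin_num => //; exact/Lfun1_integrable.
congr fine.
transitivity (\int[joint]_z k z)%E.
  rewrite /joint integral_pushforward //.
  by rewrite preimage_setT; exact/Lfun1_integrable.
transitivity (\int[mu \x nu]_z k z)%E.
  by apply: eq_measure_integral => X mX _; exact/esym/prodE.
rewrite -integral12_prod_meas1 //=.
have imu : mu.-integrable setT (EFin : R -> \bar R).
  apply: integrable_pushforward => //.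
  by rewrite preimage_setT; exact/Lfun1_integrable.
have inu : nu.-integrable setT (EFin : R -> \bar R).
  apply: integrable_pushforward => //.
  by rewrite preimage_setT; exact/Lfun1_integrable.
transitivity (\int[mu]_x (x%:E * \int[nu]_y y%:E))%E.
  apply: eq_integral => x _; rewrite -integralZl //.
rewrite /fubini_F.
have nufin : (\int[nu]_y y%:E \is a fin_num)%E by exact: integrable_fin_num.
under eq_integral do rewrite -(fineK nufin) .
rewrite integralZr // fineK //.
rewrite /mu /nu /distribution !integral_pushforward ?preimage_setT //=;
  exact/Lfun1_integrable.
Qed.

(** * Borel sets of column vectors and second-order properties of the noise *)

Lemma borel_cV_coord (R : realType) (n : nat) (i : 'I_n) (b : set R) :
  measurable b -> borel_cV [set v : 'cV[R]_n | b (v i 0)].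
Proof. by move=> mb; apply: sub_gen_smallest; exists i, b. Qed.

Lemma borel_cV_mul (R : realType) (n : nat) (i j : 'I_n) (c e : R)
    (b : set R) :
  measurable b ->
  borel_cV [set v : 'cV[R]_n | b ((v i 0 - c) * (v j 0 - e))].
Proof.
move=> mb.
pose G := [set C | exists (i : 'I_n) (b : set R),
  measurable b /\ C = [set v : 'cV[R]_n | b (v i 0)]].
pose coord (k : 'I_n) (v : g_sigma_algebraType G) : R := (v : 'cV[R]_n) k 0.
have mcoord k : measurable_fun setT (coord k).
  by move=> _ D mD; rewrite setTI; exact: borel_cV_coord.
have : measurable_fun setT (fun v => (coord i v - c) * (coord j v - e)).
  by apply: measurable_funM; apply: measurable_funB.
by move=> /(_ measurableT _ mb); rewrite setTI.
Qed.

Lemma random_vector_coord (d : measure_display) (T : measurableType d)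
    (R : realType) (n : nat) (V : T -> 'cV[R]_n) (i : 'I_n) :
  random_vector V -> measurable_fun setT (fun o => V o i 0).
Proof.
by move=> mV _ b mb; rewrite setTI; exact: (mV _ (borel_cV_coord i mb)).
Qed.

Lemma finite_moment2_Lfun (d : measure_display) (T : measurableType d)
    (R : realType) (P : probability T R) (n : nat) (V : T -> 'cV[R]_n)
    (i : 'I_n) :
  random_vector V -> finite_moment P 2 V -> (fun o => V o i 0) \in Lfun P 2%:E.
Proof.
by move=> mV V2; apply: Lfun_natP (V2 i); exact: random_vector_coord.
Qed.

Lemma finite_moment4_Lfun (d : measure_display) (T : measurableType d)
    (R : realType) (P : probability T R) (n : nat) (V : T -> 'cV[R]_n)
    (i : 'I_n) :
  random_vector V -> finite_moment P 4 V -> (fun o => V o i 0) \in Lfun P 2%:E.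
Proof.
move=> mV V4; apply: (@Lfun_subset _ _ _ P 2%:E 4%:E).
- by rewrite lee1n.
- by rewrite lee1n.
- exact: fin_num_measure.
- by rewrite lee_fin ler_nat.
- by apply: Lfun_natP (V4 i); exact: random_vector_coord.
Qed.

(** This reduces an i.i.d. sequence to what the moment recursions use: a centered, uncorrelated
    sequence with constant second moments. *)
Lemma iid_centered (d : measure_display) (T : measurableType d) (R : realType)
    (P : probability T R) (n : nat) (w : nat -> T -> 'cV[R]_n) :
  iid P w -> (forall t i, (fun o => w t o i 0) \in Lfun P 2%:E) ->
  let v t o := w t o - Emx P (w 0%N) in
  [/\ forall t i, (fun o => v t o i 0) \in Lfun P 2%:E,
      forall t i, Er P (fun o => v t o i 0) = 0,
      forall t u i j, t != u -> Er P (fun o => v t o i 0 * v u o j 0) = 0 &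
      forall t i j, Er P (fun o => v t o i 0 * v t o j 0)
                    = Er P (fun o => v 0%N o i 0 * v 0%N o j 0)].
Proof.
move=> [mw indep idist] w2 v.
have vE t i o : v t o i 0 = w t o i 0 + - Er P (fun o => w 0%N o i 0).
  by rewrite /v !mxE.
have v2 t i : (fun o => v t o i 0) \in Lfun P 2%:E.
  by under eq_fun do rewrite vE; apply: Lfun2D => //; exact: Lfun_cst.
have v0 t i : Er P (fun o => v t o i 0) = 0.
  under eq_fun do rewrite vE.
  rewrite ErD; [|exact: Lfun2_1|exact: Lfun_cst].
  rewrite Er_cst; apply/eqP; rewrite subr_eq0; apply/eqP.
  apply: Er_eq_distr; [exact: Lfun2_1|exact: Lfun2_1|move=> b mb].
  exact: (idist t _ (borel_cV_coord i mb)).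
split => // [t u i j tu|t i j].
- rewrite Er_indep // ?v0 ?mul0r // => b c mb mc.
  (* Independence is stated for the uncentered noise, so the shift by the mean is moved into the
     Borel sets. Only the values of [B] at [t] and [u] matter. *)
  have mshift (D : set R) (k : R) :
      measurable D -> measurable [set x | D (x - k)].
    move=> mD.
    have : measurable_fun setT (fun x : R => x - k) by exact: measurable_funB.
    by move=> /(_ measurableT _ mD); rewrite setTI.
  pose k i := Er P (fun o => w 0%N o i 0).
  pose B (x : nat) :=
    if x == t then [set v : 'cV[R]_n | [set y | b (y - k i)] (v i 0)]
    else [set v : 'cV[R]_n | [set y | c (y - k j)] (v j 0)].
  have mB x : borel_cV (B x).
    by rewrite /B; case: eqP => _; apply: borel_cV_coord; exact: mshift.
  have uB : uniq [:: t; u] by rewrite /= inE tu.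
  have := indep [:: t; u] B uB mB.
  rewrite !big_cons big_nil mule1.
  have Et : w t @^-1` B t = (fun o => v t o i 0) @^-1` b.
    by apply/seteqP; rewrite /B eqxx; split => o /=; rewrite vE.
  have Eu : w u @^-1` B u = (fun o => v u o j 0) @^-1` c.
    by apply/seteqP; rewrite /B eq_sym (negbTE tu); split => o /=; rewrite vE.
  rewrite Et Eu => <-; congr (P _); apply/seteqP; split => o /=.
  + move=> [ob oc] x /=; rewrite !inE => /orP[|] /eqP ->.
      have : ((fun o => v t o i 0) @^-1` b) o by [].
      by rewrite -Et.
    have : ((fun o => v u o j 0) @^-1` c) o by [].
    by rewrite -Eu.
  + move=> H; split.
      have : (w t @^-1` B t) o by apply: H; rewrite /= mem_head.
      by rewrite Et.
    have : (w u @^-1` B u) o by apply: H; rewrite /= !inE eqxx orbT.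
    by rewrite Eu.
- apply: Er_eq_distr; [exact: Lfun2_mul|exact: Lfun2_mul|move=> b mb].
  pose k i := Er P (fun o => w 0%N o i 0).
  have := idist t _ (borel_cV_mul i j (k i) (k j) mb).
  by congr (P _ = P _); apply/seteqP; split => o /=; rewrite !vE.
Qed.

(** * Convergent and geometric matrix sequences *)

Definition mx_cvg (R : realType) (p q : nat) (U : nat -> 'M[R]_(p, q))
    (L : 'M[R]_(p, q)) : Prop :=
  forall i j, U t i j @[t --> \oo] --> L i j.

Lemma mx_cvg_cst (R : realType) (p q : nat) (L : 'M[R]_(p, q)) :
  mx_cvg (fun=> L) L.
Proof. by move=> i j; exact: cvg_cst. Qed.

Lemma mx_cvgD (R : realType) (p q : nat) (U V : nat -> 'M[R]_(p, q))
    (L M : 'M[R]_(p, q)) :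
  mx_cvg U L -> mx_cvg V M -> mx_cvg (fun t => U t + V t) (L + M).
Proof.
move=> UL VM i j; under eq_cvg do rewrite mxE.
by rewrite mxE; exact: (cvgD (UL i j) (VM i j)).
Qed.

Lemma sum_cvg (R : realType) (I : Type) (s : seq I) (u : I -> nat -> R)
    (l : I -> R) :
  (forall i, u i t @[t --> \oo] --> l i) ->
  \sum_(i <- s) u i t @[t --> \oo] --> \sum_(i <- s) l i.
Proof.
move=> ul; elim: s => [|i s IH].
  by under eq_cvg do rewrite big_nil; rewrite big_nil; exact: cvg_cst.
under eq_cvg do rewrite big_cons.
by rewrite big_cons; exact: (cvgD (ul i) IH).
Qed.

Lemma mx_cvgM (R : realType) (p q r : nat) (U : nat -> 'M[R]_(p, q))
    (V : nat -> 'M[R]_(q, r)) L M :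
  mx_cvg U L -> mx_cvg V M -> mx_cvg (fun t => U t *m V t) (L *m M).
Proof.
move=> UL VM i j; under eq_cvg do rewrite mxE.
by rewrite mxE; apply: sum_cvg => k; exact: (cvgM (UL i k) (VM k j)).
Qed.

Lemma mx_cvg_tr (R : realType) (p q : nat) (U : nat -> 'M[R]_(p, q)) L :
  mx_cvg U L -> mx_cvg (fun t => (U t)^T) L^T.
Proof.
by move=> UL i j; under eq_cvg do rewrite mxE; rewrite mxE; exact: UL.
Qed.

Definition mx_geometric (R : realType) (p q : nat) (r : R)
    (U : nat -> 'M[R]_(p, q)) : Prop :=
  forall i j, exists C, forall t, `|U t i j| <= C * r ^+ t.

Lemma sum_geometric (R : realType) (I : Type) (s : seq I) (u : I -> nat -> R)
    (r : R) :
  (forall i, exists C, forall t, `|u i t| <= C * r ^+ t) ->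
  exists C, forall t, `|\sum_(i <- s) u i t| <= C * r ^+ t.
Proof.
move=> /choice[C HC]; exists (\sum_(i <- s) C i) => t.
rewrite mulr_suml; apply: (le_trans (ler_norm_sum _ _ _)).
by apply: ler_sum => i _; exact: HC.
Qed.

Lemma mx_geometricM (R : realType) (p q m : nat) (r s : R)
    (U : nat -> 'M[R]_(p, q)) (V : nat -> 'M[R]_(q, m)) :
  mx_geometric r U -> mx_geometric s V ->
  mx_geometric (r * s) (fun t => U t *m V t).
Proof.
move=> Ur Vs i j.
have [k|C HC] := @sum_geometric R _ (index_enum 'I_q)
  (fun k t => U t i k * V t k j) (r * s).
  have [C HC] := Ur i k; have [D HD] := Vs k j.
  exists (C * D) => t; rewrite normrM exprMn mulrACA.
  by rewrite ler_pM.
by exists C => t; rewrite mxE; exact: HC.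
Qed.

Lemma mx_geometric_cst (R : realType) (p q : nat) (L : 'M[R]_(p, q)) :
  mx_geometric 1 (fun=> L).
Proof. by move=> i j; exists `|L i j| => t; rewrite expr1n mulr1. Qed.

Lemma geometric_cvg0 (R : realType) (C r : R) (u : nat -> R) :
  0 < r < 1 -> (forall t, `|u t| <= C * r ^+ t) -> u t @[t --> \oo] --> 0.
Proof.
move=> /andP[r0 r1] HC; apply/norm_cvg0P.
have H0 : C * r ^+ t @[t --> \oo] --> 0.
  rewrite -(mulr0 C); apply: cvgMr; apply: cvg_expr.
  by rewrite gtr0_norm.
apply: (squeeze_cvgr _ (cvg_cst 0) H0).
by near=> t; rewrite normr_ge0 /=.
Unshelve. all: by end_near. Qed.

Lemma mx_geometric_series (R : realType) (p q : nat) (r : R)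
    (U : nat -> 'M[R]_(p, q)) :
  0 < r < 1 -> mx_geometric r U ->
  exists L, mx_cvg (fun t => \sum_(j < t) U j) L.
Proof.
move=> /andP[r0 r1] Ur.
have H i j : cvgn (series (fun t => U t i j)).
  have [C HC] := Ur i j.
  apply: normed_cvg.
  apply: (series_le_cvg _ _ HC) => [t|t|]; first exact: normr_ge0.
    exact: le_trans (normr_ge0 _) (HC t).
  by apply: is_cvg_geometric_series; rewrite gtr0_norm.
exists (\matrix_(i, j) limn (series (fun t => U t i j))) => i j.
rewrite mxE; have := H i j; rewrite /series /=.
under eq_cvg do rewrite big_mkord.
by under [X in _ -> X]eq_cvg do rewrite summxE.
Qed.

(** * Second moments of random vectors *)

Definition L2vec (d : measure_display) (T : measurableType d) (R : realType)
    (P : probability T R) (p : nat) (z : T -> 'cV[R]_p) : Prop :=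
  forall i, (fun o => z o i 0) \in Lfun P 2%:E.

(** This is the uncentered second moment matrix, the expectation of [z *m y^T]. *)
Definition cross (d : measure_display) (T : measurableType d) (R : realType)
    (P : probability T R) (p q : nat) (z : T -> 'cV[R]_p) (y : T -> 'cV[R]_q)
    : 'M[R]_(p, q) :=
  \matrix_(i, j) Er P (fun o => z o i 0 * y o j 0).

Lemma Lfun1Z (d : measure_display) (T : measurableType d) (R : realType)
    (P : probability T R) (c : R) (f : T -> R) :
  f \in Lfun P 1 -> (fun o => c * f o) \in Lfun P 1.
Proof.
move=> f1; have -> : (fun o => c * f o) = c \o* f.
  by apply/funext => o /=; rewrite mulrC.
exact: Lfun_scale.
Qed.

Lemma Lfun2Z (d : measure_display) (T : measurableType d) (R : realType)
    (P : probability T R) (c : R) (f : T -> R) :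
  f \in Lfun P 2%:E -> (fun o => c * f o) \in Lfun P 2%:E.
Proof.
move=> f2; have -> : (fun o => c * f o) = c \o* f.
  by apply/funext => o /=; rewrite mulrC.
by apply: Lfun_scale => //; rewrite ler1n.
Qed.

Lemma Lfun2_sum (d : measure_display) (T : measurableType d) (R : realType)
    (P : probability T R) (I : Type) (s : seq I) (f : I -> T -> R) :
  (forall i, f i \in Lfun P 2%:E) ->
  (fun o => \sum_(i <- s) f i o) \in Lfun P 2%:E.
Proof.
move=> f2; elim: s => [|i s IH].
  by under eq_fun do rewrite big_nil; exact: Lfun_cst.
by under eq_fun do rewrite big_cons; exact: Lfun2D.
Qed.

Lemma L2vec_cst (d : measure_display) (T : measurableType d) (R : realType)
    (P : probability T R) (p : nat) (c : 'cV[R]_p) : L2vec P (fun=> c).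
Proof. by move=> i; exact: Lfun_cst. Qed.

Lemma L2vecD (d : measure_display) (T : measurableType d) (R : realType)
    (P : probability T R) (p : nat) (z y : T -> 'cV[R]_p) :
  L2vec P z -> L2vec P y -> L2vec P (fun o => z o + y o).
Proof.
by move=> z2 y2 i; under eq_fun do rewrite mxE; exact: Lfun2D (z2 i) (y2 i).
Qed.

Lemma L2vecM (d : measure_display) (T : measurableType d) (R : realType)
    (P : probability T R) (p q : nat) (G : 'M[R]_(q, p)) (z : T -> 'cV[R]_p) :
  L2vec P z -> L2vec P (fun o => G *m z o).
Proof.
move=> z2 i; under eq_fun do rewrite mxE.
by apply: Lfun2_sum => k; exact: Lfun2Z.
Qed.

Lemma cross_tr (d : measure_display) (T : measurableType d) (R : realType)
    (P : probability T R) (p q : nat) (z : T -> 'cV[R]_p) (y : T -> 'cV[R]_q) :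
  (cross P z y)^T = cross P y z.
Proof.
apply/matrixP => i j; rewrite !mxE; congr Er.
by apply/funext => o; rewrite mulrC.
Qed.

Lemma crossDl (d : measure_display) (T : measurableType d) (R : realType)
    (P : probability T R) (p q : nat) (z z' : T -> 'cV[R]_p)
    (y : T -> 'cV[R]_q) :
  L2vec P z -> L2vec P z' -> L2vec P y ->
  cross P (fun o => z o + z' o) y = cross P z y + cross P z' y.
Proof.
move=> z2 z2' y2; apply/matrixP => i j; rewrite !mxE -ErD; last 2 first.
- exact: Lfun2_mul.
- exact: Lfun2_mul.
by congr Er; apply/funext => o; rewrite mxE mulrDl.
Qed.

Lemma crossMl (d : measure_display) (T : measurableType d) (R : realType)
    (P : probability T R) (p q m : nat) (G : 'M[R]_(m, p)) (z : T -> 'cV[R]_p)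
    (y : T -> 'cV[R]_q) :
  L2vec P z -> L2vec P y ->
  cross P (fun o => G *m z o) y = G *m cross P z y.
Proof.
move=> z2 y2; apply/matrixP => i j; rewrite !mxE.
have zy1 k : (fun o => z o k 0 * y o j 0) \in Lfun P 1 by exact: Lfun2_mul.
under eq_bigr do rewrite mxE -ErZ //.
rewrite -(proj2 (Er_sum _ _)) => [|k].
  congr Er; apply/funext => o; rewrite mxE mulr_suml.
  by apply: eq_bigr => k _; rewrite mulrA.
exact: Lfun1Z.
Qed.

Lemma crossDr (d : measure_display) (T : measurableType d) (R : realType)
    (P : probability T R) (p q : nat) (z : T -> 'cV[R]_p)
    (y y' : T -> 'cV[R]_q) :
  L2vec P z -> L2vec P y -> L2vec P y' ->
  cross P z (fun o => y o + y' o) = cross P z y + cross P z y'.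
Proof. by move=> ? ? ?; rewrite -cross_tr crossDl // raddfD /= !cross_tr. Qed.

Lemma crossMr (d : measure_display) (T : measurableType d) (R : realType)
    (P : probability T R) (p q m : nat) (G : 'M[R]_(m, q)) (z : T -> 'cV[R]_p)
    (y : T -> 'cV[R]_q) :
  L2vec P z -> L2vec P y ->
  cross P z (fun o => G *m y o) = cross P z y *m G^T.
Proof. by move=> ? ?; rewrite -cross_tr crossMl // trmx_mul cross_tr. Qed.

Lemma cross_cstr (d : measure_display) (T : measurableType d) (R : realType)
    (P : probability T R) (p q : nat) (z : T -> 'cV[R]_p) (c : 'cV[R]_q) :
  L2vec P z -> cross P z (fun=> c) = Emx P z *m c^T.
Proof.
move=> z2; apply/matrixP => i j.
rewrite !mxE big_ord1 !mxE mulrC -ErZ; last first.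
  exact: Lfun2_1.
by congr Er; apply/funext => o; rewrite mulrC.
Qed.

Lemma cross_cstl (d : measure_display) (T : measurableType d) (R : realType)
    (P : probability T R) (p q : nat) (c : 'cV[R]_p) (z : T -> 'cV[R]_q) :
  L2vec P z -> cross P (fun=> c) z = c *m (Emx P z)^T.
Proof. by move=> z2; rewrite -cross_tr cross_cstr // trmx_mul trmxK. Qed.

(** A mean is a second moment against the constant 1, so linearity of [Emx] is inherited from
    [cross]. *)
Lemma Emx_cross (d : measure_display) (T : measurableType d) (R : realType)
    (P : probability T R) (p : nat) (z : T -> 'cV[R]_p) :
  Emx P z = cross P z (fun=> const_mx 1 : 'cV[R]_1).
Proof.
apply/matrixP => i j; rewrite !mxE; congr Er; apply/funext => o.
by rewrite mulr1 (ord1 j).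
Qed.

Lemma Emx_cst (d : measure_display) (T : measurableType d) (R : realType)
    (P : probability T R) (p : nat) (c : 'cV[R]_p) : Emx P (fun=> c) = c.
Proof. by apply/matrixP => i j; rewrite mxE Er_cst. Qed.

Lemma EmxD (d : measure_display) (T : measurableType d) (R : realType)
    (P : probability T R) (p : nat) (z y : T -> 'cV[R]_p) :
  L2vec P z -> L2vec P y -> Emx P (fun o => z o + y o) = Emx P z + Emx P y.
Proof. by move=> ? ?; rewrite !Emx_cross crossDl //; exact: L2vec_cst. Qed.

Lemma EmxM (d : measure_display) (T : measurableType d) (R : realType)
    (P : probability T R) (p q : nat) (G : 'M[R]_(q, p)) (z : T -> 'cV[R]_p) :
  L2vec P z -> Emx P (fun o => G *m z o) = G *m Emx P z.
Proof. by move=> ?; rewrite !Emx_cross crossMl //; exact: L2vec_cst. Qed.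

Lemma qformE (R : realType) (p : nat) (M : 'M[R]_p) (x : 'cV[R]_p) :
  qform M x = \sum_i \sum_j M j i * (x j 0 * x i 0).
Proof.
rewrite /qform mxE; apply: eq_bigr => i _; rewrite mxE mulr_suml.
by apply: eq_bigr => j _; rewrite !mxE; ring.
Qed.

Lemma Er_qform (d : measure_display) (T : measurableType d) (R : realType)
    (P : probability T R) (p : nat) (M : 'M[R]_p) (z : T -> 'cV[R]_p) :
  L2vec P z ->
  (fun o => qform M (z o)) \in Lfun P 1 /\
  Er P (fun o => qform M (z o)) = \tr (M *m cross P z z).
Proof.
move=> z2; under eq_fun do rewrite qformE.
have zz1 i j : (fun o => z o i 0 * z o j 0) \in Lfun P 1 by exact: Lfun2_mul.
have in1 i : (fun o => \sum_j M j i * (z o j 0 * z o i 0)) \in Lfun P 1.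
  by apply: (proj1 (Er_sum _ _)) => j; exact: Lfun1Z.
split; first exact: (proj1 (Er_sum _ _)).
rewrite (proj2 (Er_sum _ in1)) mxtrace_mulC; apply: eq_bigr => i _.
rewrite mxE (proj2 (Er_sum _ _)) => [|j]; last exact: Lfun1Z.
apply: eq_bigr => j _; rewrite ErZ // mxE mulrC; congr (Er _ _ * _).
by apply/funext => o; rewrite mulrC.
Qed.

Lemma Er_dot (d : measure_display) (T : measurableType d) (R : realType)
    (P : probability T R) (p : nat) (q : 'cV[R]_p) (z : T -> 'cV[R]_p) :
  L2vec P z ->
  (fun o => ((z o)^T *m q) 0 0) \in Lfun P 1 /\
  Er P (fun o => ((z o)^T *m q) 0 0) = ((Emx P z)^T *m q) 0 0.
Proof.
move=> z2; under eq_fun do rewrite mxE.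
have in1 i : (fun o => (z o)^T 0 i * q i 0) \in Lfun P 1.
  by under eq_fun do rewrite mxE mulrC; apply: Lfun1Z; exact: Lfun2_1.
split; first exact: (proj1 (Er_sum _ in1)).
rewrite (proj2 (Er_sum _ in1)) mxE; apply: eq_bigr => i _.
under eq_fun do rewrite mxE mulrC.
by rewrite ErZ ?mxE 1?mulrC //; exact: Lfun2_1.
Qed.

Arguments mx_cvg_cst {R p q} L.
Arguments mx_geometric_cst {R p q} L.

(** * Convergence of first and second moments along the closed loop *)

Definition moments_cvg (d : measure_display) (T : measurableType d)
    (R : realType) (P : probability T R) (p : nat) (z : nat -> T -> 'cV[R]_p)
    : Prop :=
  [/\ forall t, L2vec P (z t),
      exists m, mx_cvg (fun t => Emx P (z t)) m
    & exists S, mx_cvg (fun t => cross P (z t) (z t)) S].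

(** This carries convergence from the states to the controls, which are affine in them. *)
Lemma moments_cvg_affine (d : measure_display) (T : measurableType d)
    (R : realType) (P : probability T R) (p q : nat) (G : 'M[R]_(q, p))
    (l : 'cV[R]_q) (z : nat -> T -> 'cV[R]_p) :
  moments_cvg P z -> moments_cvg P (fun t o => G *m z t o + l).
Proof.
move=> [z2 [m zm] [S zS]].
have Gz2 t := L2vecM G (z2 t).
have l2 := L2vec_cst P l.
split; first by move=> t; exact: (L2vecD (Gz2 t) l2).
  exists (G *m m + l).
  have -> : (fun t => Emx P (fun o => G *m z t o + l))
            = (fun t => G *m Emx P (z t) + l).
    by apply/funext => t; rewrite (EmxD (Gz2 t) l2) EmxM // Emx_cst.
  by apply: mx_cvgD; [apply: mx_cvgM|]; [exact: mx_cvg_cst| |exact: mx_cvg_cst].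
exists (G *m S *m G^T + G *m m *m l^T + (l *m (G *m m)^T + l *m l^T)).
have -> : (fun t => cross P (fun o => G *m z t o + l) (fun o => G *m z t o + l))
          = (fun t => G *m cross P (z t) (z t) *m G^T + G *m Emx P (z t) *m l^T
                      + (l *m (G *m Emx P (z t))^T + l *m l^T)).
  apply/funext => t.
  rewrite (crossDl (Gz2 t) l2 (L2vecD (Gz2 t) l2)).
  rewrite (crossDr (Gz2 t) (Gz2 t) l2) (crossDr l2 (Gz2 t) l2).
  rewrite crossMl // crossMr // mulmxA !cross_cstr // !cross_cstl // !EmxM //.
  by rewrite Emx_cst.
have zm' := mx_cvgM (mx_cvg_cst G) zm.
apply: mx_cvgD; apply: mx_cvgD.
- by apply: mx_cvgM (mx_cvg_cst _); apply: mx_cvgM zS; exact: mx_cvg_cst.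
- exact: mx_cvgM zm' (mx_cvg_cst _).
- exact: mx_cvgM (mx_cvg_cst _) (mx_cvg_tr zm').
- exact: mx_cvg_cst.
Qed.

(** A weak Cauchy-Schwarz inequality, read off from the squares of [f + g] and [f - g]; it controls
    the correlation of the initial state with the noise response. *)
Lemma Er_mul_le (d : measure_display) (T : measurableType d) (R : realType)
    (P : probability T R) (f g : T -> R) :
  f \in Lfun P 2%:E -> g \in Lfun P 2%:E ->
  `|Er P (fun o => f o * g o)|
    <= Er P (fun o => f o * f o) + Er P (fun o => g o * g o).
Proof.
move=> f2 g2.
have [[fg1 ff1] gg1] := (Lfun2_mul f2 g2, Lfun2_mul f2 f2, Lfun2_mul g2 g2).
have sum1 : (fun o => f o * f o + g o * g o) \in Lfun P 1.
  by apply: (@rpredD _ (Lfun P 1)).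
rewrite -ErD // ler_norml; apply/andP; split.
  rewrite lerNl -mulN1r -ErZ //; apply: Er_le => // [|o]; first exact: Lfun1Z.
  have := sqr_ge0 (f o + g o); have := sqr_ge0 (f o); have := sqr_ge0 (g o).
  rewrite !expr2; lra.
apply: Er_le => // o.
have := sqr_ge0 (f o - g o); have := sqr_ge0 (f o); have := sqr_ge0 (g o).
rewrite !expr2; lra.
Qed.

Fixpoint noise_response (T : Type) (R : realType) (n : nat) (F : 'M[R]_n)
    (v : nat -> T -> 'cV[R]_n) (t : nat) (o : T) : 'cV[R]_n :=
  if t is t'.+1 then F *m noise_response F v t' o + v t' o else 0.

(** The response at time [t] involves only [v u] with [u < t], hence is uncorrelated with [v t]. The
    mixed terms vanish and the second moments obey a Lyapunov recursion, solved by the partial sums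
    in the conclusion. *)
Lemma noise_response_moments (d : measure_display) (T : measurableType d)
    (R : realType) (P : probability T R) (n : nat) (F : 'M[R]_n)
    (v : nat -> T -> 'cV[R]_n) :
  (forall t, L2vec P (v t)) -> (forall t, Emx P (v t) = 0) ->
  (forall t u, t != u -> cross P (v t) (v u) = 0) ->
  (forall t, cross P (v t) (v t) = cross P (v 0%N) (v 0%N)) ->
  let y := noise_response F v in
  [/\ forall t, L2vec P (y t), forall t, Emx P (y t) = 0
    & forall t, cross P (y t) (y t) =
        \sum_(j < t) F ^+ j *m cross P (v 0%N) (v 0%N) *m (F ^+ j)^T].
Proof.
move=> v2 v0 vort vcov y.
have y2 t : L2vec P (y t).
  elim: t => [|t IH]; first exact: L2vec_cst.
  exact: (L2vecD (L2vecM F IH) (v2 t)).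
have y0 t : Emx P (y t) = 0.
  elim: t => [|t IH]; first exact: Emx_cst.
  by rewrite (EmxD (L2vecM F (y2 t)) (v2 t)) EmxM // IH v0 mulmx0 addr0.
have yv t u : (t <= u)%N -> cross P (y t) (v u) = 0.
  elim: t => [|t IH] tu.
    by rewrite (cross_cstl 0 (v2 u)) mul0mx.
  rewrite (crossDl (L2vecM F (y2 t)) (v2 t) (v2 u)) crossMl // IH 1?ltnW //.
  by rewrite mulmx0 add0r vort // ltn_eqF.
have yS t : cross P (y t.+1) (y t.+1)
            = F *m cross P (y t) (y t) *m F^T + cross P (v 0%N) (v 0%N).
  have Fy := L2vecM F (y2 t).
  rewrite (crossDl Fy (v2 t) (L2vecD Fy (v2 t))).
  rewrite (crossDr Fy Fy (v2 t)) (crossDr (v2 t) Fy (v2 t)).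
  rewrite !crossMl // !crossMr // yv // mulmx0 addr0 mulmxA.
  by rewrite -(cross_tr P (y t) (v t)) yv // trmx0 mul0mx add0r vcov.
split => //; elim=> [|t IH].
  by rewrite big_ord0 (cross_cstl 0 (y2 0%N)) mul0mx.
rewrite yS IH big_ord_recl expr0 trmx1 mulmx1 mul1mx addrC; congr (_ + _).
rewrite mulmx_sumr mulmx_suml; apply: eq_bigr => j _.
by rewrite lift0 exprS -mulmxE trmx_mul !mulmxA.
Qed.

(* [z 0] may be correlated with the noise, so [z t] is split into
   [F ^+ t *m z 0], a deterministic part [m t] and the response [y t] to the
   centered noise; [F ^+ t] kills the correlation of the first with the last. *)
Lemma stable_moments_cvg (d : measure_display) (T : measurableType d)
    (R : realType) (P : probability T R) (n : nat) (F : 'M[R]_n) (c : 'cV[R]_n)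
    (v z : nat -> T -> 'cV[R]_n) :
  spectral_radius F < 1 ->
  (forall t, L2vec P (v t)) -> (forall t, Emx P (v t) = 0) ->
  (forall t u, t != u -> cross P (v t) (v u) = 0) ->
  (forall t, cross P (v t) (v t) = cross P (v 0%N) (v 0%N)) ->
  L2vec P (z 0%N) -> (forall t o, z t.+1 o = F *m z t o + c + v t o) ->
  moments_cvg P z.
Proof.
move=> Frho v2 v0 vort vcov z2 zS.
have [r r01 Fr] := stable_power_bound Frho.
have [y2 y0 ycov] := noise_response_moments F v2 v0 vort vcov.
move: y2 y0 ycov; set y := noise_response F v => y2 y0 ycov.
pose m t := \sum_(j < t) F ^+ j *m c.
have mS t : m t.+1 = F *m m t + c.
  rewrite /m big_ord_recl expr0 mul1mx addrC mulmx_sumr; congr (_ + _).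
  by apply: eq_bigr => j _; rewrite lift0 exprS -mulmxE mulmxA.
have zE t o : z t o = F ^+ t *m z 0%N o + (m t + y t o).
  elim: t => [|t IH]; first by rewrite /m big_ord0 expr0 mul1mx !addr0.
  rewrite zS IH mS exprS -mulmxE !mulmxDr mulmxA -!addrA.
  by congr (_ + (_ + _)); rewrite addrCA.
have Fgeo : mx_geometric r (fun t => F ^+ t) by [].
have F0 : mx_cvg (fun t => F ^+ t) 0.
  by move=> i j; have [C HC] := Fr i j; rewrite mxE; exact: geometric_cvg0 HC.
have [mu mmu] : exists mu, mx_cvg m mu.
  have := mx_geometricM Fgeo (mx_geometric_cst c).
  by rewrite mulr1 => /(mx_geometric_series r01).
have [Y ycvg] : exists Y, mx_cvg (fun t => cross P (y t) (y t)) Y.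
  (* This is the ratio that [mx_geometricM] yields for [F ^+ j], a constant matrix (ratio 1) and
     [(F ^+ j)^T]. *)
  have rr : 0 < r * 1 * r < 1.
    move/andP: r01 => [r0 r1]; rewrite mulr1 mulr_gt0 //=.
    by rewrite mulr_ilt1 // ltW.
  have FTgeo : mx_geometric r (fun t => (F ^+ t)^T).
    by move=> i j; have [C HC] := Fr j i; exists C => t; rewrite mxE.
  have := mx_geometricM
    (mx_geometricM Fgeo (mx_geometric_cst (cross P (v 0%N) (v 0%N)))) FTgeo.
  move=> /(mx_geometric_series rr)[Y HY]; exists Y.
  by move=> i j; under eq_cvg do rewrite ycov; exact: HY.
pose p t o := F ^+ t *m z 0%N o.
have p2 t : L2vec P (p t) by exact: L2vecM.
have my2 t : L2vec P (fun o => m t + y t o).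
  by apply: L2vecD => //; exact: L2vec_cst.
have zfun t : z t = (fun o => p t o + (m t + y t o)).
  by apply/funext => o; exact: zE.
have my_mean t : Emx P (fun o => m t + y t o) = m t.
  by rewrite EmxD // ?Emx_cst ?y0 ?addr0 //; exact: L2vec_cst.
have p_mean : mx_cvg (fun t => Emx P (p t)) 0.
  have := mx_cvgM F0 (mx_cvg_cst (Emx P (z 0%N))); rewrite mul0mx.
  by congr mx_cvg; apply/funext => t; rewrite EmxM.
split; first by move=> t; rewrite zfun; exact: L2vecD.
  exists (0 + mu).
  have -> : (fun t => Emx P (z t)) = (fun t => Emx P (p t) + m t).
    by apply/funext => t; rewrite zfun EmxD // my_mean.
  exact: mx_cvgD.
have zy : mx_cvg (fun t => F ^+ t *m cross P (z 0%N) (y t)) 0.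
  move=> i j; under eq_cvg do rewrite mxE.
  have -> : (0 : 'M[R]_n) i j = \sum_(k < n) (0 : R) by rewrite mxE big1.
  apply: sum_cvg => k; apply/norm_cvg0P.
  pose e0 := Er P (fun o => z 0%N o k 0 * z 0%N o k 0).
  (* The correlation is at most [e0] plus a convergent second moment, while the entry of [F ^+ t]
     tends to 0. *)
  have H0 : `|(F ^+ t) i k| * (e0 + cross P (y t) (y t) j j) @[t --> \oo] --> 0.
    have -> : 0 = 0 * (e0 + Y j j) by rewrite mul0r.
    apply: cvgM.
      by apply/norm_cvg0P; have := F0 i k; rewrite mxE.
    by apply: cvgD; [exact: cvg_cst|exact: ycvg].
  apply: (squeeze_cvgr _ (cvg_cst 0) H0).
  near=> t; rewrite normr_ge0 normrM ler_wpM2l // !mxE.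
  by apply: Er_mul_le; [exact: z2|exact: y2].
have pmy : mx_cvg (fun t => cross P (p t) (fun o => m t + y t o)) 0.
  have -> : (fun t => cross P (p t) (fun o => m t + y t o)) =
            (fun t => Emx P (p t) *m (m t)^T + F ^+ t *m cross P (z 0%N) (y t)).
    apply/funext => t; rewrite crossDr //; last exact: L2vec_cst.
    by rewrite cross_cstr // crossMl.
  have := mx_cvgD (mx_cvgM p_mean (mx_cvg_tr mmu)) zy.
  by rewrite mul0mx addr0.
(* The limit is left unsimplified so that it mirrors the decomposition below term by term. *)
exists (0 *m cross P (z 0%N) (z 0%N) *m 0^T + 0 + (0^T + (mu *m mu^T + Y))).
have -> : (fun t => cross P (z t) (z t)) =
          (fun t => F ^+ t *m cross P (z 0%N) (z 0%N) *m (F ^+ t)^T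
             + cross P (p t) (fun o => m t + y t o)
             + ((cross P (p t) (fun o => m t + y t o))^T
                + (m t *m (m t)^T + cross P (y t) (y t)))).
  apply/funext => t; rewrite zfun.
  rewrite (crossDl (p2 t) (my2 t) (L2vecD (p2 t) (my2 t))).
  rewrite (crossDr (p2 t) (p2 t) (my2 t)) (crossDr (my2 t) (p2 t) (my2 t)).
  rewrite [cross P (p t) (p t)]crossMl // crossMr // mulmxA.
  rewrite -(cross_tr P (p t) (fun o => m t + y t o)).
  have mc := L2vec_cst P (m t).
  congr (_ + (_ + _)).
  rewrite [LHS](crossDl mc (y2 t) (my2 t)) cross_cstl // my_mean.
  rewrite (crossDr (y2 t) mc (y2 t)).
  by rewrite cross_cstr // y0 mul0mx add0r.
by repeat first [exact: pmy|exact: mmu|exact: F0|exact: ycvg|exact: mx_cvg_cst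
  |apply: mx_cvg_tr|apply: mx_cvgD|apply: mx_cvgM].
Unshelve. all: by end_near. Qed.

(** * Average costs of stabilizing policies *)

Lemma avg_cost_lim (d : measure_display) (T : measurableType d) (R : realType)
    (P : probability T R) (c : nat -> T -> R) (l : R) :
  (forall t, c t \in Lfun P 1) -> Er P (c t) @[t --> \oo] --> l ->
  avg_cost P c = l.
Proof.
(* [arithmetic_mean] divides by [n.+1]; the shift discards the horizon 0 and aligns [avg_cost] with
   it. *)
move=> c1 cl; apply/cvg_lim => //; rewrite -cvg_shiftS.
have := cesaro cl; rewrite /arithmetic_mean /series /=.
by under [X in _ -> X]eq_cvg do rewrite (proj2 (Er_sum _ c1)).
Qed.

(** * Pointwise bounds on quadratic costs *)

Lemma pdmx_unitmx (R : realType) (n : nat) (W : 'M[R]_n) :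
  pdmx W -> W \in unitmx.
Proof.
move=> [_ Wpos]; rewrite -row_free_unit; apply: inj_row_free => v vW.
apply/eqP; apply: contraT => v0.
have : v^T != 0.
  by apply: contraNneq v0 => /(congr1 trmx); rewrite trmxK trmx0 => ->.
by move/Wpos; rewrite /qform trmxK vW mul0mx mxE ltxx.
Qed.

(* Completing the square: the minimum is attained at [- W^-1 q / 2]. *)
Lemma pdmx_quad_lower (R : realType) (n : nat) (W : 'M[R]_n) (q : 'cV[R]_n) :
  pdmx W -> exists c, forall y, - c <= qform W y + (y^T *m q) 0 0.
Proof.
move=> Wpd; have [Wt Wpos] := Wpd.
pose h := 2^-1 *: (invmx W *m q).
have Wh : W *m h = 2^-1 *: q.
  by rewrite -scalemxAr mulmxA mulmxV ?mul1mx ?pdmx_unitmx.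
exists (qform W h) => y.
suff -> : qform W y + (y^T *m q) 0 0 = qform W (y + h) - qform W h.
  rewrite lerBrDr addrC subrr.
  by have [->|/Wpos/ltW //] := eqVneq (y + h) 0; rewrite /qform mulmx0 mxE.
have hWy : (h^T *m W *m y) 0 0 = (y^T *m W *m h) 0 0.
  by rewrite -[RHS]trace_mx11 -mxtrace_tr !trmx_mul trmxK Wt mulmxA trace_mx11.
have tD : (y + h)^T = y^T + h^T by rewrite linearD.
rewrite /qform tD !mulmxDl !mulmxDr.
have -> : y^T *m q = y^T *m W *m h + y^T *m W *m h.
  have h2 : 2^-1 + 2^-1 = 1 :> R by lra.
  by rewrite -!mulmxA Wh -mulmxDr -scalerDl h2 scale1r.
rewrite !mxE in hWy *; rewrite hWy; ring.
Qed.

(** The product of two coordinates is at most the squared length in absolute value, so the sum of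
    the moduli of the entries of [M] serves as constant. *)
Lemma qform_le_sqr (R : realType) (n : nat) (M : 'M[R]_n) :
  exists2 c, 0 <= c & forall y, qform M y <= c * (y^T *m y) 0 0.
Proof.
exists (\sum_i \sum_j `|M j i|) => [|y].
  by do 2! (apply: sumr_ge0 => ? _).
have sqrE : (y^T *m y) 0 0 = \sum_k y k 0 ^+ 2.
  by rewrite mxE; apply: eq_bigr => k _; rewrite mxE expr2.
rewrite qformE mulr_suml; apply: ler_sum => i _.
rewrite mulr_suml; apply: ler_sum => j _.
apply: (le_trans (ler_norm _)); rewrite normrM ler_wpM2l //.
have le1 k : y k 0 ^+ 2 <= (y^T *m y) 0 0.
  by rewrite sqrE (bigD1 k) //= lerDl sumr_ge0 // => ? _; exact: sqr_ge0.
have := le1 i; have := le1 j.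
have := sqr_ge0 (y j 0 - y i 0); have := sqr_ge0 (y j 0 + y i 0).
rewrite ler_norml !expr2; move=> *; apply/andP; split; lra.
Qed.

Lemma dot_le (R : realType) (n : nat) (y q : 'cV[R]_n) :
  (y^T *m q) 0 0 <= (y^T *m y) 0 0 + (q^T *m q) 0 0.
Proof.
rewrite !mxE -big_split; apply: ler_sum => i _ /=; rewrite !mxE.
have := sqr_ge0 (y i 0 - q i 0); have := sqr_ge0 (y i 0 + q i 0).
rewrite !expr2; lra.
Qed.

(** * Convergence of the expected costs under a stabilizing policy *)

Lemma lqr_moments_cvg (d : measure_display) (T : measurableType d)
    (R : realType) (P : probability T R) (n m : nat) (s : lqr P n m)
    (X : policy R n m) :
  iid P (noise s) -> (forall t, finite_moment P 4 (noise s t)) ->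
  random_vector (x0 s) -> finite_moment P 2 (x0 s) ->
  stabilizing s X -> moments_cvg P (state s X).
Proof.
move=> hiid hw4 hx0 hx02 sX.
have w2 t i : (fun o => noise s t o i 0) \in Lfun P 2%:E.
  by case: hiid => mw _ _; exact: finite_moment4_Lfun.
have [v2 v0 vort vcov] := iid_centered hiid w2.
(* The mean of the noise joins the constant drift, leaving a centered perturbation. *)
apply: (@stable_moments_cvg _ _ _ _ _ _ (mB s *m X.2 + wbar s)
  (fun t o => noise s t o - wbar s) _ sX) => //.
- by move=> t; apply/matrixP => i j; rewrite (ord1 j) !mxE; exact: v0.
- by move=> t u tu; apply/matrixP => i j; rewrite !mxE; exact: vort.
- by move=> t; apply/matrixP => i j; rewrite !mxE; exact: vcov.
- by move=> i; exact: finite_moment2_Lfun.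
move=> t o /=; rewrite /control mulmxDr mulmxN mulmxBl -!addrA mulmxA.
by congr (_ + (_ + (_ + _))); rewrite addrC subrK.
Qed.

Lemma Er_qform_cvg (d : measure_display) (T : measurableType d)
    (R : realType) (P : probability T R) (p : nat) (M : 'M[R]_p)
    (z : nat -> T -> 'cV[R]_p) :
  moments_cvg P z ->
  exists l : R, Er P (fun o => qform M (z t o)) @[t --> \oo] --> l.
Proof.
move=> [z2 _ [S zS]]; exists (\tr (M *m S)).
under eq_cvg do rewrite (proj2 (Er_qform _ (z2 _))).
by apply: sum_cvg => i; exact: (mx_cvgM (mx_cvg_cst M) zS).
Qed.

Lemma Er_dot_cvg (d : measure_display) (T : measurableType d)
    (R : realType) (P : probability T R) (p : nat) (q : 'cV[R]_p)
    (z : nat -> T -> 'cV[R]_p) :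
  moments_cvg P z ->
  exists l : R, Er P (fun o => ((z t o)^T *m q) 0 0) @[t --> \oo] --> l.
Proof.
move=> [z2 [m zm] _]; exists ((m^T *m q) 0 0).
under eq_cvg do rewrite (proj2 (Er_dot _ (z2 _))).
exact: (mx_cvgM (mx_cvg_tr zm) (mx_cvg_cst q)).
Qed.

Lemma J_cvg (d : measure_display) (T : measurableType d) (R : realType)
    (P : probability T R) (n m : nat) (s : lqr P n m) (X : policy R n m) :
  moments_cvg P (state s X) ->
  let cost t o :=
    qform (mQ s) (state s X t o) + qform (mR s) (control X (state s X t o)) in
  (forall t, cost t \in Lfun P 1) /\ Er P (cost t) @[t --> \oo] --> J s X.
Proof.
move=> zc cost.
have uc : moments_cvg P (fun t o => control X (state s X t o)).
  have := moments_cvg_affine (- X.1) X.2 zc; congr moments_cvg.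
  by apply/funext => t; apply/funext => o; rewrite /control mulNmx.
have [l1 xl] := Er_qform_cvg (mQ s) zc; have [l2 ul] := Er_qform_cvg (mR s) uc.
have [z2 _ _] := zc; have [u2 _ _] := uc.
have x1 t := proj1 (Er_qform (mQ s) (z2 t)).
have u1 t := proj1 (Er_qform (mR s) (u2 t)).
have c1 t : cost t \in Lfun P 1.
  by apply: (@rpredD _ (Lfun P 1)); [exact: x1|exact: u1].
have cl : Er P (cost t) @[t --> \oo] --> l1 + l2.
  under eq_cvg do rewrite (ErD (x1 _) (u1 _)).
  exact: cvgD.
by split => //; rewrite (_ : J s X = l1 + l2) //; exact: avg_cost_lim.
Qed.

Lemma Jc_cvg (d : measure_display) (T : measurableType d) (R : realType)
    (P : probability T R) (n m : nat) (s : lqr P n m) (X : policy R n m) :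
  moments_cvg P (state s X) ->
  let cost t o :=
    4 * qform (mQ s *m covW s *m mQ s) (state s X t o)
    + 4 * ((state s X t o)^T *m mQ s *m M3 s) 0 0 in
  (forall t, cost t \in Lfun P 1) /\ Er P (cost t) @[t --> \oo] --> Jc s X.
Proof.
move=> zc cost.
have [l1 xl] := Er_qform_cvg (mQ s *m covW s *m mQ s) zc.
have [l2 ul] := Er_dot_cvg (mQ s *m M3 s) zc.
have [z2 _ _] := zc.
have x1 t := proj1 (Er_qform (mQ s *m covW s *m mQ s) (z2 t)).
have u1 t := proj1 (Er_dot (mQ s *m M3 s) (z2 t)).
have costE : cost = (fun t o =>
    4 * qform (mQ s *m covW s *m mQ s) (state s X t o)
    + 4 * ((state s X t o)^T *m (mQ s *m M3 s)) 0 0).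
  by apply/funext => t; apply/funext => o; rewrite /cost mulmxA.
have c1 t : cost t \in Lfun P 1.
  rewrite costE; apply: (@rpredD _ (Lfun P 1)); apply: Lfun1Z.
    exact: x1.
  exact: u1.
have cl : Er P (cost t) @[t --> \oo] --> 4 * l1 + 4 * l2.
  rewrite costE; under eq_cvg do
    rewrite (ErD (Lfun1Z _ (x1 _)) (Lfun1Z _ (u1 _)))
      (ErZ _ (x1 _)) (ErZ _ (u1 _)).
  by apply: cvgD; apply: cvgMr.
by split => //; rewrite (_ : Jc s X = 4 * l1 + 4 * l2) //; exact: avg_cost_lim.
Qed.

(** In the variable [Q *m x] the cost is a quadratic with positive definite leading matrix [4 *: W],
    hence bounded below. In the variable [S *m x] both terms are controlled by the squared length,
    which is [qform Q x]. *)
Lemma risk_cost_bounds (R : realType) (n : nat) (Q S W : 'M[R]_n)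
    (q : 'cV[R]_n) :
  pdmx W -> Q^T = Q -> is_sqrtmx Q S ->
  exists c0 c c1 : R, 0 <= c /\ forall x,
    - c0 <= 4 * qform (Q *m W *m Q) x + 4 * (x^T *m Q *m q) 0 0
         <= c * qform Q x + c1.
Proof.
move=> Wpd Qt [[St _] SQ].
have [c0 Hlow] := pdmx_quad_lower q Wpd.
have [c c_ge0 Hup] := qform_le_sqr (S *m W *m S).
exists (4 * c0), (4 * c + 4), (4 * ((S *m q)^T *m (S *m q)) 0 0).
split=> [|x]; [lra|apply/andP; split].
- have := Hlow (Q *m x); rewrite /qform trmx_mul Qt !mulmxA; lra.
- have := Hup (S *m x); have := dot_le (S *m x) (S *m q).
  rewrite /qform !trmx_mul St !mulmxA; do !rewrite -(mulmxA _ S S) SQ.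
  lra.
Qed.

(** * The dual iteration *)

(** Only the affine dependence on the multiplier matters here. Since [g] need not be bounded above
    on [S], its bound by an affine function of [j] is what limits the supergradients along the
    iteration. *)
Lemma dual_ascent_rate (R : realType) (U : Type) (S : set U) (j g : U -> R)
    (G0 c c1 : R) (zeta : nat -> R) (X : nat -> U) (mu : nat -> R) :
  0 <= G0 -> 0 <= c ->
  (forall Y, S Y -> - G0 <= g Y <= c * j Y + c1) ->
  (exists2 Y, S Y & g Y < 0) ->
  order_invsqrt zeta -> 0 <= mu 1%N ->
  (forall k, (1 <= k)%N ->
     is_argmin S (fun Y => j Y + mu k * g Y) (X k) /\
     mu k.+1 = Num.max 0 (mu k + zeta k * g (X k))) ->
  let D nu := ereal_inf [set (j Y + nu * g Y)%:E | Y in S] in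
  let Dmax := ereal_sup [set D nu | nu in [set nu : R | 0 <= nu]] in
  [/\ Dmax \is a fin_num,
      exists2 mus : R, 0 <= mus & D mus = Dmax
    & exists C : R, forall k, (1 <= k)%N ->
        (Dmax - D (running_mean mu k) <= (C / Num.sqrt k%:R)%:E)%E].
Proof.
move=> G00 c0 bnd [Y0 SY0 gY0] [a [b [a0 b0 zab]]] mu1 step D Dmax.
have D_le nu Y : S Y -> (D nu <= (j Y + nu * g Y)%:E)%E.
  by move=> SY; apply: ereal_inf_lbound; exists Y.
have le_D nu r : (forall Y, S Y -> r <= j Y + nu * g Y) -> (r%:E <= D nu)%E.
  by move=> H; apply: le_ereal_inf_tmp => _ [Y SY <-]; rewrite lee_fin H.
have D_le_max nu : 0 <= nu -> (D nu <= Dmax)%E.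
  by move=> nu0; apply: ereal_sup_ubound; exists nu.
have mu0 k : (1 <= k)%N -> 0 <= mu k.
  case: k => // -[|k] _ //; have [_ ->] := step k.+1 isT.
  by rewrite le_max lexx.
have SX k : (1 <= k)%N -> S (X k) by move=> /step[[]].
have D_at k : (1 <= k)%N -> D (mu k) = (j (X k) + mu k * g (X k))%:E.
  move=> k1; apply/le_anti/andP; split; first exact: D_le _ _ (SX k k1).
  by apply: le_D => Y SY; have [[_ /(_ _ SY)]] := step k k1.
(* Below, [D (mu 1%N)] is finite because its minimum is attained; above, [j Y0] at the Slater point
   dominates every [D nu]. *)
have Dmax_fin : Dmax \is a fin_num.
  apply/fin_numPlt; apply/andP; split.
    by rewrite (lt_le_trans _ (D_le_max _ mu1)) // D_at // ltNyr.
  apply: (@le_lt_trans _ _ (j Y0)%:E); last exact: ltry.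
  apply: ge_ereal_sup => _ [nu nu0 <-]; apply: (le_trans (D_le nu _ SY0)).
  by rewrite lee_fin gerDl mulr_ge0_le0 // ltW.
have [r Er] : exists r, Dmax = r%:E by exists (fine Dmax); rewrite fineK.
(* Near-maximizers exist by definition of the supremum; the Slater point keeps them from escaping to
   infinity. *)
have [mus mus0 mus_max] : exists2 mus, 0 <= mus &
    forall Y, S Y -> r <= j Y + mus * g Y.
  apply: affine_family_max; first by exists Y0.
  move=> e e0; have [_ [nu nu0 <-]] := ub_ereal_sup_adherent e0 Dmax_fin.
  rewrite -/Dmax Er => lt_nu; exists nu => // Y SY.
  by rewrite -lee_fin EFinB; apply: le_trans (D_le _ _ SY); exact: ltW.
split => //.
  exists mus => //; apply/le_anti; rewrite D_le_max //= Er.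
  exact: le_D.
pose gap k := r - (j (X k) + mu k * g (X k)).
have gap0 k : (1 <= k)%N -> 0 <= gap k.
  by move=> k1; rewrite subr_ge0 -lee_fin -D_at // -Er D_le_max // mu0.
have gap_le k : (1 <= k)%N -> gap k <= g (X k) * (mus - mu k).
  move=> k1; have := mus_max _ (SX _ k1); rewrite /gap; lra.
(* When [mu k <= mus] the growth condition bounds [g (X k)]; otherwise
   [g (X k) <= 0], as a supergradient to the right of the maximizer. *)
pose G := G0 + `|c * (r + mus * G0) + c1|.
have gG k : (1 <= k)%N -> `|g (X k)| <= G.
  move=> k1; have /andP[glow gup] := bnd _ (SX _ k1).
  have nG := normr_ge0 (c * (r + mus * G0) + c1).
  rewrite ler_norml; apply/andP; split; first by rewrite /G; lra.
  have [mu_le|mu_gt] := leP (mu k) mus.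
    (* Combine [j (X k) + mu k * g (X k) <= r] with [g (X k) >= - G0] and [mu k <= mus]. *)
    have jle : j (X k) <= r + mus * G0.
      have := gap0 _ k1; rewrite /gap.
      have := ler_wpM2l (mu0 _ k1) glow; have := ler_wpM2r G00 mu_le; lra.
    have := ler_wpM2l c0 jle; have := ler_norm (c * (r + mus * G0) + c1).
    rewrite /G; lra.
  have gle : g (X k) <= 0.
    have := le_trans (gap0 _ k1) (gap_le _ k1).
    by rewrite nmulr_lge0 // subr_lt0.
  rewrite /G; lra.
have G_ge0 : 0 <= G by rewrite addr_ge0.
have sqrt_ge1 k : (1 <= k)%N -> 1 <= Num.sqrt k%:R :> R.
  by move=> k1; rewrite -[leLHS]sqrtr1 ler_wsqrtr // ler1n.
pose C := b * G ^+ 2 + (b * G) ^+ 2 / a.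
have C_ge0 : 0 <= C.
  by rewrite addr_ge0 // ?divr_ge0 ?mulr_ge0 ?sqr_ge0 // ltW.
have onestep k : (1 <= k)%N ->
    gap k <= Num.sqrt k%:R / a * ((mu k - mus) ^+ 2 - (mu k.+1 - mus) ^+ 2)
             + C / Num.sqrt k%:R /\
    (`|mu k.+1 - mus| <= `|mu k - mus| \/
     `|mu k.+1 - mus| <= b * G / Num.sqrt k%:R).
  move=> k1; have [_ muS] := step k k1.
  apply: (ascent_step a0 b0 _ (zab k k1) (gG k k1) mus0 muS (gap0 k k1)
    (gap_le k k1)).
  exact: lt_le_trans ltr01 (sqrt_ge1 k k1).
(* A step that increases the distance to [mus] ends within [b * G / Num.sqrt k%:R] of it, at most
   [b * G]. *)
pose M := `|mu 1%N - mus| + b * G.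
have bG0 : 0 <= b * G by rewrite mulr_ge0 // ltW.
have dist_le k : (1 <= k)%N -> `|mu k - mus| <= M.
  elim: k => // -[|k] IH _; first by rewrite /M lerDl.
  have [_ [H|H]] := onestep k.+1 isT; first exact: le_trans H (IH isT).
  apply: (le_trans H); apply: (@le_trans _ _ (b * G)); last by rewrite /M lerDr.
  rewrite ler_pdivrMr ?(lt_le_trans ltr01) ?sqrt_ge1 //.
  by rewrite ler_peMr // sqrt_ge1.
have sum_gap := @ascent_sum R C (M ^+ 2) a gap (fun k => mu k - mus) a0 C_ge0
  (fun k k1 => proj1 (onestep k k1)).
exists (2 * C + M ^+ 2 / a) => k k1.
have {}sum_gap : \sum_(1 <= i < k.+1) gap i
    <= (2 * C + M ^+ 2 / a) * Num.sqrt k%:R.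
  apply: sum_gap => i i1.
  rewrite -(real_normK (num_real (mu i - mus))).
  by rewrite lerXn2r ?nnegrE ?addr_ge0 // dist_le.
have k0 : 0 < k%:R :> R by rewrite ltr0n.
(* Concavity: at the running mean each affine function takes the average of its values at the
   [mu i], each at least the minimum found at [mu i]. *)
have D_mean : ((k%:R^-1 * \sum_(1 <= i < k.+1) (j (X i) + mu i * g (X i)))%:E
               <= D (running_mean mu k))%E.
  apply: le_D => Y SY.
  have -> : j Y + running_mean mu k * g Y =
      k%:R^-1 * \sum_(1 <= i < k.+1) (j Y + mu i * g Y).
    rewrite big_split /= sumr_const_nat subn1 /= mulrDr.
    rewrite -(mulr_natl (j Y)) mulKf ?gt_eqF //.
    by rewrite /running_mean -mulrA mulr_suml.
  apply: ler_wpM2l; first by rewrite invr_ge0 ltW.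
  apply: ler_sum_nat => i /andP[i1 _].
  by have [[_ /(_ _ SY)]] := step i i1.
rewrite Er; apply: (le_trans (leeB (lexx _) D_mean)).
rewrite -EFinB lee_fin.
have -> : r - k%:R^-1 * \sum_(1 <= i < k.+1) (j (X i) + mu i * g (X i))
          = k%:R^-1 * \sum_(1 <= i < k.+1) gap i.
  rewrite /gap sumrB sumr_const_nat subn1 /= mulrBr.
  by rewrite -(mulr_natl r) mulKf ?gt_eqF.
have kinv0 : 0 <= k%:R^-1 :> R by rewrite invr_ge0 ltW.
apply: (le_trans (ler_wpM2l kinv0 sum_gap)).
have q0 : 0 < Num.sqrt k%:R :> R by apply: lt_le_trans (sqrt_ge1 k k1).
have -> : k%:R = Num.sqrt k%:R ^+ 2 :> R by rewrite sqr_sqrtr // ltW.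
rewrite sqrtr_sqr gtr0_norm // le_eqVlt; apply/orP; left; apply/eqP.
by field; rewrite !gt_eqF.
Qed.

(** The pointwise inequalities are integrated at each time and pass to the limit; the control cost,
    being nonnegative, can be added to the upper bound. *)
Lemma lqr_cost_bounds (d : measure_display) (T : measurableType d)
    (R : realType) (P : probability T R) (n m : nat) (s : lqr P n m)
    (Qhalf : 'M[R]_n) :
  iid P (noise s) -> (forall t, finite_moment P 4 (noise s t)) ->
  pdmx (covW s) -> random_vector (x0 s) -> finite_moment P 2 (x0 s) ->
  psdmx (mQ s) -> pdmx (mR s) -> is_sqrtmx (mQ s) Qhalf ->
  exists c0 c c1 : R, 0 <= c /\ forall X, stabilizing s X ->
    - c0 <= Jc s X <= c * J s X + c1.
Proof.
move=> hiid hw4 hW hx0 hx02 [Qt Qpos] [_ Rpos] hQhalf.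
have [c0 [c [c1 [c_ge0 Hbnd]]]] := risk_cost_bounds (M3 s) hW Qt hQhalf.
exists c0, c, c1; split => // X sX.
have zc := lqr_moments_cvg hiid hw4 hx0 hx02 sX.
have [J1 Jl] := J_cvg zc; have [Jc1 Jcl] := Jc_cvg zc.
have R_ge0 u : 0 <= qform (mR s) u.
  by have [->|/Rpos/ltW //] := eqVneq u 0; rewrite /qform mulmx0 mxE.
apply/andP; split.
  apply: (cvgr_to_ge Jcl); near=> t.
  rewrite -(Er_cst P (- c0)); apply: Er_le => // [|o]; first exact: Lfun_cst.
  by have /andP[] := Hbnd (state s X t o).
pose cost t o :=
  qform (mQ s) (state s X t o) + qform (mR s) (control X (state s X t o)).
have upl : c * Er P (cost t) + c1 @[t --> \oo] --> c * J s X + c1.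
  by apply: cvgD; [apply: cvgM => //; exact: cvg_cst|exact: cvg_cst].
apply: (ler_cvg_to Jcl upl); near=> t.
have -> : c * Er P (cost t) + c1 = Er P (fun o => c * cost t o + c1).
  rewrite [RHS]ErD; [|by apply: Lfun1Z; exact: J1|exact: Lfun_cst].
  by rewrite Er_cst ErZ //; exact: J1.
apply: Er_le => // [|o].
  by apply: (@rpredD _ (Lfun P 1)); [apply: Lfun1Z; exact: J1|exact: Lfun_cst].
have /andP[_ /le_trans] := Hbnd (state s X t o); apply.
by rewrite lerD2r ler_wpM2l // lerDl.
Unshelve. all: by end_near. Qed.

Theorem theorem4 (d : measure_display) (T : measurableType d) (R : realType)
    (P : probability T R) (n m : nat) (s : lqr P n m) (Qhalf : 'M[R]_n)
    (hiid : iid P (noise s))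
    (hw4 : forall t, finite_moment P 4 (noise s t))
    (hW : pdmx (covW s))
    (hx0 : random_vector (x0 s)) (hx02 : finite_moment P 2 (x0 s))
    (hQ : psdmx (mQ s)) (hR : pdmx (mR s))
    (hQhalf : is_sqrtmx (mQ s) Qhalf)
    (hctrl : controllable (mA s) (mB s))
    (hobs : observable (mA s) Qhalf)
    (hrho0 : 0 < rho0 s)
    (slater : exists2 X, stabilizing s X & Jc s X < rhobar s)
    (zeta : nat -> R) (X : nat -> policy R n m) (mu : nat -> R)
    (hzeta : order_invsqrt zeta)
    (hmu1 : 0 <= mu 1%N)
    (hpd : primal_dual s zeta X mu) :
  [/\ dual_max s \is a fin_num,
      exists2 mustar : R, 0 <= mustar & dual s mustar = dual_max s
    & exists C : R, forall k, (1 <= k)%N ->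
        (dual_max s - dual s (running_mean mu k)
           <= (C / Num.sqrt k%:R)%:E)%E].
Proof.
have [c0 [c [c1 [c_ge0 bnd]]]] :=
  lqr_cost_bounds hiid hw4 hW hx0 hx02 hQ hR hQhalf.
(* The bounds on [Jc] are shifted by [rhobar s]; the absolute value supplies a nonnegative
   constant. *)
apply: (@dual_ascent_rate _ _ (stabilizing s) (J s) (fun Y => Jc s Y - rhobar s)
  `|c0 + rhobar s| c (c1 - rhobar s) zeta X) => // [Y sY|].
- by have /andP[glow gup] := bnd Y sY; have := ler_norm (c0 + rhobar s); lra.
- by have [Y sY Yrho] := slater; exists Y => //; rewrite subr_lt0.
Qed.
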